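(* Let $n\ge 1$, $R>0$, $p>0$, $q>0$, $\lambda>0$, let $B_R\subset\mathbb{R}^n$ be the ball of radius $R$ centred at the origin, and let $\eta$ be the outward unit normal on $\partial B_R$. Let $u_0$ be a nonnegative, radially symmetric, nondecreasing (in $r=|x|$), smooth function on $\overline{B}_R$ satisfying $$\frac{\partial u_0}{\partial \eta}=e^{qu_0}\ \text{ on } \partial B_R,\qquad \Delta u_0+\lambda e^{pu_0}\ge 0,\quad u_{0r}(|x|)\ge 0\ \text{ for } x\in\overline{B}_R,$$ and moreover assume that for some constant $a>0$ $$\Delta u_0+\lambda e^{pu_0}\ge a>0\quad\text{in }\overline{B}_R.$$ Let $u$ be a solution, with finite blow-up time $T$, of $$u_t=\Delta u+\lambda e^{pu}\ \text{ in } B_R\times(0,T),\qquad \frac{\partial u}{\partial\eta}=e^{qu}\ \text{ on }\partial B_R\times(0,T),\qquad u(x,0)=u_0(x)\ \text{ for } x\in B_R.$$ Then there is a positive constant $C$ such that $$u(R,t)\le \log C-\frac{1}{q}\log(T-t),\qquad t\in(0,T).$$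
   Context: Solutions are classical solutions of the initial-boundary value problem. The solution is radial in $x$, and one writes $u(x,t)=u(r,t)$ and $u_0(x)=u_0(r)$ with $r=|x|$; thus $u(R,t)$ is the value of $u(\cdot,t)$ on $\partial B_R$. A subscript $r$ denotes the radial derivative. The blow-up time $T$ is the finite maximal existence time of the classical solution, at which $\max_{\overline{B}_R}u(\cdot,t)\to\infty$ as $t\to T^-$. *)

(* Defs.v *)
From HB Require Import structures.
From mathcomp Require Import all_boot all_order all_algebra.
From mathcomp Require Import all_classical all_reals all_analysis.
Set Implicit Arguments.
Unset Strict Implicit.
Unset Printing Implicit Defensive.
Import Order.TTheory GRing.Theory Num.Theory.
Import numFieldNormedType.Exports.
Local Open Scope classical_set_scope.
Local Open Scope ring_scope.

(* The norm `|x| of the library on 'rV[K]_n is the sup norm, hence a separate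
   Euclidean norm. Both induce the same topology, so that the library's
   neighbourhoods, limits and directional derivatives can be used as they are. *)
Definition enorm (K : realType) (n : nat) (x : 'rV[K]_n) : K :=
  Num.sqrt (\sum_(i < n) x 0 i ^+ 2).

Definition oball (K : realType) (n : nat) (R : K) : set 'rV[K]_n :=
  [set x | enorm x < R].
Arguments oball {K} n R _.

Definition cball (K : realType) (n : nat) (R : K) : set 'rV[K]_n :=
  [set x | enorm x <= R].
Arguments cball {K} n R _.

Definition partial (K : realType) (n : nat) (i : 'I_n) (f : 'rV[K]_n -> K) :
    'rV[K]_n -> K :=
  fun x => 'D_(delta_mx 0 i) f x.

Definition partials (K : realType) (n : nat) (s : seq 'I_n)
    (f : 'rV[K]_n -> K) : 'rV[K]_n -> K :=
  foldr (@partial K n) f s.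

Definition laplacian (K : realType) (n : nat) (f : 'rV[K]_n -> K) :
    'rV[K]_n -> K :=
  fun x => \sum_(i < n) partial i (partial i f) x.

(* Derivatives of a function on a closed domain are taken in the interior D and
   extended to the boundary by continuity. At a point of D where f is
   continuous, trace D f x = f x. *)
Definition trace (K : realType) (V : topologicalType) (D : set V) (f : V -> K) :
    V -> K :=
  fun x => lim (f y @[y --> within D (nbhs x)]).

(* f, given on D, extends continuously to the subset E of the closure of D.
   When D is contained in E this includes the continuity of f on D. *)
Definition extends_to (K : realType) (V : topologicalType) (D E : set V)
    (f : V -> K) : Prop :=
  forall x, E x -> cvg (f y @[y --> within D (nbhs x)]).

Definition smooth_cball (K : realType) (n : nat) (R : K) (f : 'rV[K]_n -> K) :
    Prop :=
  [/\ {within cball n R, continuous f},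
      forall (s : seq 'I_n) (i : 'I_n) (x : 'rV[K]_n),
        oball n R x -> derivable (partials s f) x (delta_mx 0 i) &
      forall s : seq 'I_n, extends_to (oball n R) (cball n R) (partials s f)].

(* The outward unit normal of the ball at a boundary point x is x / R. *)
Definition normal_derivative (K : realType) (n : nat) (R : K)
    (f : 'rV[K]_n -> K) (x : 'rV[K]_n) : K :=
  \sum_(i < n) (x 0 i / R) * trace (oball n R) (partial i f) x.

(* f_r(|x|). At x = 0 division by 0 gives 0, which is the value f_r(0) for a
   radial function of class C^1. *)
Definition radial_derivative (K : realType) (n : nat) (R : K)
    (f : 'rV[K]_n -> K) (x : 'rV[K]_n) : K :=
  \sum_(i < n) (x 0 i / enorm x) * trace (oball n R) (partial i f) x.

Definition radial_on_cball (K : realType) (n : nat) (R : K)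
    (f : 'rV[K]_n -> K) : Prop :=
  forall x y, cball n R x -> cball n R y -> enorm x = enorm y -> f x = f y.

Definition nondecreasing_in_radius (K : realType) (n : nat) (R : K)
    (f : 'rV[K]_n -> K) : Prop :=
  forall x y, cball n R x -> cball n R y -> enorm x <= enorm y -> f x <= f y.

Definition dt (K : realType) (n : nat) (u : 'rV[K]_n -> K -> K) :
    'rV[K]_n -> K -> K :=
  fun x t => derive1 (u x) t.

(* Class C^{2,1} on (closed ball) x (0, T). *)
Definition C21 (K : realType) (n : nat) (R T : K) (u : 'rV[K]_n -> K -> K) :
    Prop :=
  let D := oball n R `*` [set t : K | 0 < t < T] in
  let E := cball n R `*` [set t : K | 0 < t < T] in
  [/\ forall (x : 'rV[K]_n) (t : K), oball n R x -> 0 < t < T ->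
        [/\ derivable (u x) t 1,
            forall i : 'I_n, derivable (u ^~ t) x (delta_mx 0 i) &
            forall i j : 'I_n,
              derivable (partial i (u ^~ t)) x (delta_mx 0 j)],
      {within E, continuous (fun z : 'rV[K]_n * K => u z.1 z.2)},
      extends_to D E (fun z : 'rV[K]_n * K => dt u z.1 z.2),
      forall i : 'I_n, extends_to D E (fun z : 'rV[K]_n * K => partial i (u ^~ z.2) z.1) &
      forall i j : 'I_n,
        extends_to D E (fun z : 'rV[K]_n * K => partial j (partial i (u ^~ z.2)) z.1)].

(* Classical solution on [0, T): of class C^{2,1} on (closed ball) x (0, T) and
   continuous on (closed ball) x [0, T). *)
Record classical_solution (K : realType) (n : nat) (R p q lambda : K)
    (u0 : 'rV[K]_n -> K) (T : K) (u : 'rV[K]_n -> K -> K) : Prop := {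
  sol_C21 : C21 R T u ;
  sol_continuous :
    {within cball n R `*` [set t : K | 0 <= t < T],
      continuous (fun z : 'rV[K]_n * K => u z.1 z.2)} ;
  sol_pde : forall (x : 'rV[K]_n) (t : K), oball n R x -> 0 < t < T ->
    dt u x t = laplacian (u ^~ t) x + lambda * expR (p * u x t) ;
  sol_boundary : forall (x : 'rV[K]_n) (t : K), enorm x = R -> 0 < t < T ->
    normal_derivative R (u ^~ t) x = expR (q * u x t) ;
  sol_initial : forall x, oball n R x -> u x 0 = u0 x
}.

(* T is the maximal existence time of u and the maximum of u over the closed
   ball (a sup of a continuous function on a compact set) tends to infinity. *)
Definition blowup_time (K : realType) (n : nat) (R p q lambda : K)
    (u0 : 'rV[K]_n -> K) (T : K) (u : 'rV[K]_n -> K -> K) : Prop :=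
  (~ exists (T' : K) (v : 'rV[K]_n -> K -> K),
       [/\ T < T', classical_solution R p q lambda u0 T' v &
           forall (x : 'rV[K]_n) (t : K), cball n R x -> 0 <= t < T -> v x t = u x t]) /\
  sup [set u x t | x in cball n R] @[t --> T^'-] --> +oo.

(* Main.v *)
Require Import Defs.
From HB Require Import structures.
From mathcomp Require Import all_boot all_order all_algebra.
From mathcomp Require Import all_classical all_reals all_analysis.
From mathcomp Require Import ring lra.
Set Implicit Arguments.
Unset Strict Implicit.
Unset Printing Implicit Defensive.
Import Order.TTheory GRing.Theory Num.Theory.
Import numFieldNormedType.Exports.
Local Open Scope classical_set_scope.
Local Open Scope ring_scope.

(** The statement [u_t >= eps u_r] at [r = R] would follow from the maximum
    principle for [u_t - eps u_r], but [u] is only of class C^{2,1}. It is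
    replaced by a two-point comparison. Comparing [u] with [u0 + a t], and then
    [u (t + h)] with [u t + a h], gives [u r (t + h) >= u r t + a h]. For a fixed
    small [eps] and all small [h], the function [u (r - eps h) (t + h) - u r t]
    is then nonnegative on [[eps h, R]] after a positive time. At [r = R], where
    [u_r = exp (q u)], this gives
    [u R (t + h) >= u R t + (eps / 2) h exp (q u R (t + h))], so that
    [exp (- q u R t)] loses at least [q eps h / 2] on every time step [h]; summing
    the steps up to [T] bounds it from below by a multiple of [T - t]. *)

(** * Calculus on intervals and rectangles *)

(** For smooth [u], the function [J = u_t - eps u_r] would solve a linear parabolic equation with
    source [eps (n - 1) u_r / r^2], and on [r = R] one would have [J_r = q exp (q u) u_t - eps u_rr
    >= (q - eps) u_t > 0], because [u >= 0] and [u_t >= a], and because the equation gives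
    [u_rr <= u_t] there. The two-point function reproduces each of these signs at a positive step
    [h], up to errors measured by moduli of continuity; the slack between [eps <= q / 2] and [q]
    pays for them. The other constraint, [eps u_r < a] at the starting time, makes the two-point
    function positive there. The starting time is [T / 2] since the derivatives of [u] are not
    controlled down to [t = 0]. The moduli, hence the admissible steps [h], may degenerate as the
    upper time [T1] tends to [T]. But [eps] does not depend on [T1], so the rate [q eps / 2]
    survives the limit. *)

Lemma is_derive_approx (K : realType) (f : K -> K) (c l : K) :
  is_derive c 1 f l -> forall e, 0 < e ->
  exists2 d, 0 < d & forall x, `|x - c| < d ->
    `|f x - f c - l * (x - c)| <= e * `|x - c|.
Proof.
move=> df e e0.
have df1 : h^-1 *: ((f \o shift c) (h *: 1) - f c) @[h --> 0^'] --> l.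
  by have [dfc <-] := df; exact: dfc.
have /cvgrPdist_lt /(_ e e0) := df1.
rewrite near_withinE => /nbhs_ballP[d d0 H]; exists d => // x xd.
have [->|xc] := eqVneq x c; first by rewrite !subrr mulr0 subrr normr0 mulr0.
have xc0 : x - c != 0 by rewrite subr_eq0.
have /= := H (x - c); rewrite /ball/= sub0r normrN => /(_ xd xc0).
rewrite /shift /= [_ *: 1]mulr1 subrK => /ltW H1.
have E : (x - c) * ((x - c)^-1 *: (f x - f c)) = f x - f c by exact: mulVKf.
have -> : f x - f c - l * (x - c) = (x - c) * - (l - (x - c)^-1 *: (f x - f c)).
  by rewrite -{1}E; ring.
by rewrite normrM normrN mulrC ler_wpM2r.
Qed.

Lemma MVT_itv (K : realType) (f g : K -> K) (a b : K) : a < b ->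
  {within `[a, b], continuous f} ->
  (forall x, a < x < b -> is_derive x 1 f (g x)) ->
  exists c, a < c < b /\ f b - f a = g c * (b - a).
Proof.
move=> ab cf df.
have df' x : x \in `]a, b[ -> is_derive x 1 f (g x) by rewrite in_itv => /df.
have [c cab E] := MVT ab df' cf.
by exists c; move: cab; rewrite in_itv.
Qed.

Lemma MVT_closed (K : realType) (f g : K -> K) (a b : K) : a < b ->
  (forall x, a <= x <= b -> is_derive x 1 f (g x)) ->
  exists c, a < c < b /\ f b - f a = g c * (b - a).
Proof.
move=> ab df; apply: MVT_itv => //.
  apply: derivable_within_continuous => x; rewrite in_itv/= => xab.
  by have [] := df x xab.
by move=> x /andP[ax xb]; apply: df; rewrite !ltW.
Qed.

(** Only the right side of [c] enters, so the left end of an interval is covered too. If [l < 0],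
    then [g] is negative just after [c], and the mean value theorem takes [f] below [f c]. *)
Lemma second_derive_ge0 (K : realType) (f g : K -> K) (c b l : K) : c < b ->
  (forall x, c <= x < b -> is_derive x 1 f (g x)) -> g c = 0 ->
  is_derive c 1 g l -> (forall x, c <= x < b -> f c <= f x) -> 0 <= l.
Proof.
move=> cb df gc dg fmin; rewrite leNgt; apply/negP => l0.
have [|d d0 H] := is_derive_approx dg (e := - l / 2); first by lra.
set y := c + Num.min (d / 2) ((b - c) / 2).
have m0 : 0 < Num.min (d / 2) ((b - c) / 2) by rewrite lt_min; apply/andP; split; lra.
have [m1 m2] : Num.min (d / 2) ((b - c) / 2) <= d / 2
    /\ Num.min (d / 2) ((b - c) / 2) <= (b - c) / 2.
  by rewrite !ge_min !lexx orbT.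
have cy : c < y by rewrite /y; lra.
have yb : y < b by rewrite /y; lra.
have [x xcy|x [/andP[cx xy] E]] := @MVT_closed K f g c y cy.
  by apply: df; lra.
have := fmin y; rewrite (ltW cy) yb => /(_ isT).
have := H x; rewrite gc subr0 gtr0_norm; last lra.
have xd : x - c < d by rewrite /y in xy; lra.
move=> /(_ xd); rewrite ler_norml => /andP[_ H1].
suff : g x * (y - c) < 0 by lra.
rewrite nmulr_rlt0; first lra.
suff : l * (x - c) < 0 by lra.
rewrite nmulr_rlt0//; lra.
Qed.

Lemma derive_left_le0 (K : realType) (f : K -> K) (a c l : K) : a < c ->
  is_derive c 1 f l -> (forall x, a < x < c -> f c <= f x) -> l <= 0.
Proof.
move=> ac df fmin; rewrite leNgt; apply/negP => l0.
have [|d d0 H] := is_derive_approx df (e := l / 2); first by lra.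
set m := Num.min (d / 2) ((c - a) / 2).
have m0 : 0 < m by rewrite lt_min; apply/andP; split; lra.
have [m1 m2] : m <= d / 2 /\ m <= (c - a) / 2 by rewrite !ge_min !lexx orbT.
have := H (c - m); rewrite addrAC subrr add0r normrN gtr0_norm //.
have md : m < d by lra.
move=> /(_ md); rewrite ler_norml => /andP[_ H1].
have := fmin (c - m); have -> : a < c - m < c by lra.
move=> /(_ isT) H2.
have : 0 < l * m by exact: mulr_gt0.
lra.
Qed.

Lemma derive_right_ge0 (K : realType) (f : K -> K) (c b l : K) : c < b ->
  is_derive c 1 f l -> (forall x, c < x < b -> f c <= f x) -> 0 <= l.
Proof.
move=> cb df fmin; rewrite leNgt; apply/negP => l0.
have [|d d0 H] := is_derive_approx df (e := - l / 2); first by lra.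
set m := Num.min (d / 2) ((b - c) / 2).
have m0 : 0 < m by rewrite lt_min; apply/andP; split; lra.
have [m1 m2] : m <= d / 2 /\ m <= (b - c) / 2 by rewrite !ge_min !lexx orbT.
have := H (c + m); rewrite addrAC subrr add0r gtr0_norm //.
have md : m < d by lra.
move=> /(_ md); rewrite ler_norml => /andP[_ H1].
have := fmin (c + m); have -> : c < c + m < b by lra.
move=> /(_ isT) H2.
have : l * m < 0 by rewrite nmulr_rlt0.
lra.
Qed.

(** * Uniform continuity on compact sets and the first zero of a function on a rectangle *)

Lemma within_continuous_eps (K : realType) (V : pseudoMetricType K) (A : set V)
    (f : V -> K) : {within A, continuous f} -> forall x, A x ->
  forall e, 0 < e -> exists2 d, 0 < d & forall y, A y -> ball x d y ->
    `|f y - f x| < e.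
Proof.
move=> /subspace_continuousP cf x Ax e e0.
have /cvgrPdist_lt /(_ e e0) := cf x Ax.
rewrite near_withinE => /nbhs_ballP[d d0 H]; exists d => // y Ay xy.
by rewrite distrC; exact: H.
Qed.

(** Heine-Cantor, with near-covering compactness in place of a finite subcover: each [x] settles all
    small radii at once for the points near it. *)
Lemma compact_uniformly_continuous (K : realType) (V : pseudoMetricType K)
    (A : set V) (f : V -> K) : compact A -> {within A, continuous f} ->
  forall e, 0 < e -> exists2 d, 0 < d &
    forall x y, A x -> A y -> ball x d y -> `|f x - f y| < e.
Proof.
move=> cA cf e e0.
have : \forall d \near (0 : K)^'+, A `<=` (fun x => A x -> forall y, A y -> ball x d y ->
    `|f x - f y| < e).
  apply: ((compact_near_coveringP A).1 cA) => x Ax.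
  have [|d d0 H] := within_continuous_eps cf Ax (e := e / 2); first by lra.
  exists (ball x (d / 2), [set r | 0 < r] `&` [set r | r < d / 2]); first split => /=.
  - by apply: nbhsx_ballx; lra.
  - apply: filterI; first exact: nbhs_right_gt.
    by apply: nbhs_right_lt; lra.
  - move=> [x' r] /= [xx' [r0 rd]] Ax' y Ay x'y.
    have Hx' : `|f x' - f x| < e / 2.
      by apply: H => //; apply: le_ball xx'; lra.
    have Hy : `|f y - f x| < e / 2.
      apply: H => //; apply: ball_split xx' _; apply: le_ball x'y; lra.
    have -> : f x' - f y = (f x' - f x) - (f y - f x) by ring.
    by have := ler_normB (f x' - f x) (f y - f x); lra.
case/nbhs_ballP => d /= d0 H; exists (d / 2); first by lra.
move=> x y Ax Ay xy; have /= := H (d / 2); rewrite /ball/= sub0r normrN.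
rewrite gtr0_norm; last lra.
by apply => //; lra.
Qed.

Definition rect (K : realType) (a b c d : K) : set (K * K) :=
  [set` `[a, b]] `*` [set` `[c, d]].

Lemma rectP (K : realType) (a b c d r t : K) :
  rect a b c d (r, t) <-> a <= r <= b /\ c <= t <= d.
Proof. by rewrite /rect /setX /= !in_itv /=. Qed.

Lemma compact_rect (K : realType) (a b c d : K) : compact (rect a b c d).
Proof. by apply: compact_setX; exact: segment_compact. Qed.

Definition continuous2 (K : realType) (A : set (K * K)) (f : K -> K -> K) :=
  {within A, continuous (fun z : K * K => f z.1 z.2)}.

Lemma continuous2W (K : realType) (A B : set (K * K)) (f : K -> K -> K) :
  A `<=` B -> continuous2 B f -> continuous2 A f.
Proof. by move=> AB; exact: continuous_subspaceW. Qed.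

Lemma ball_pairE (K : realType) (r t r' t' d : K) :
  ball (r, t) d (r', t') <-> `|r - r'| < d /\ `|t - t'| < d.
Proof. by []. Qed.

Lemma continuous2_uniform (K : realType) (a b c d : K) (f : K -> K -> K) :
  continuous2 (rect a b c d) f -> forall e, 0 < e -> exists2 k, 0 < k &
  forall r t r' t', a <= r <= b -> c <= t <= d -> a <= r' <= b -> c <= t' <= d ->
    `|r - r'| < k -> `|t - t'| < k -> `|f r t - f r' t'| < e.
Proof.
move=> cf e e0.
have [k k0 H] := compact_uniformly_continuous (@compact_rect K a b c d) cf e0.
exists k => // r t r' t' *; apply: (H (r, t) (r', t')).
- exact/rectP.
- exact/rectP.
- exact/ball_pairE.
Qed.

Lemma continuous2_bounded (K : realType) (a b c d : K) (f : K -> K -> K) :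
  continuous2 (rect a b c d) f -> exists2 M, 0 < M &
  forall r t, a <= r <= b -> c <= t <= d -> `|f r t| <= M.
Proof.
move=> cf.
have /compact_bounded[M [_ HM]] := continuous_compact cf (@compact_rect K a b c d).
exists (`|M| + 1); first by have := normr_ge0 M; lra.
move=> r t rab tcd; apply: (HM (`|M| + 1)).
  by have := ler_norm M; lra.
by exists (r, t) => //; exact/rectP.
Qed.

Lemma continuous2_of_eps (K : realType) (A : set (K * K)) (f : K -> K -> K) :
  (forall r t, A (r, t) -> forall e, 0 < e -> exists2 d, 0 < d &
    forall r' t', A (r', t') -> `|r - r'| < d -> `|t - t'| < d ->
      `|f r t - f r' t'| < e) -> continuous2 A f.
Proof.
move=> H; apply/subspace_continuousP => -[r t] Art.
apply/cvgrPdist_lt => e e0; rewrite near_withinE.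
have [d d0 Hd] := H r t Art e e0.
by apply/nbhs_ballP; exists d => // -[r' t'] /ball_pairE[] /= *; exact: Hd.
Qed.

Lemma continuous2_section (K : realType) (a b c d t : K) (f : K -> K -> K) :
  continuous2 (rect a b c d) f -> c <= t <= d ->
  {within `[a, b], continuous (f ^~ t)}.
Proof.
move=> cf tcd; apply/subspace_continuousP => r /=; rewrite in_itv/= => rab.
apply/cvgrPdist_lt => e e0; rewrite near_withinE.
have [k k0 H] := continuous2_uniform cf e0.
apply/nbhs_ballP; exists k => // r' rr'; rewrite /= in_itv/= => r'ab.
by apply: H => //; rewrite subrr normr0.
Qed.

(** The set where [z <= 0] is compact, so if nonempty it has a point of least time [t]. A negative
    value at time [t] would persist slightly earlier by continuity, against minimality; hence
    [z >= 0] at time [t] and the minimizing point is a zero. *)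
Lemma first_zero (K : realType) (a b t0 t1 : K) (z : K -> K -> K) :
  continuous2 (rect a b t0 t1) z -> (forall r, a <= r <= b -> 0 < z r t0) ->
  (forall r t, a <= r <= b -> t0 <= t <= t1 -> 0 < z r t) \/
  exists r t, [/\ a <= r <= b, t0 < t <= t1, z r t = 0,
    forall s, a <= s <= b -> 0 <= z s t &
    forall s t', a <= s <= b -> t0 <= t' < t -> 0 < z s t'].
Proof.
move=> cz z0.
pose N := [set x : K * K | rect a b t0 t1 x /\ z x.1 x.2 <= 0].
have [[x0 Nx0]|/forallNP N0] := pselect (exists x, N x); last first.
  left => r t rab ttt; rewrite ltNge; apply/negP => zle.
  by apply: (N0 (r, t)); split => //; apply/rectP.
right.
have cN : compact N.
  have -> : N = rect a b t0 t1 `&` (fun x => z x.1 x.2) @^-1` [set y | y <= 0] by [].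
  apply: (subclosed_compact _ (@compact_rect K a b t0 t1)); last by move=> x [].
  have crect : closed (rect a b t0 t1).
    apply: compact_closed; first exact: (@norm_hausdorff _ (K * K)%type).
    exact: compact_rect.
  rewrite closed_setSI //.
  apply: (@preimage_closed (subspace (rect a b t0 t1))); last exact: closed_le.
  by move=> x _; exact: cz.
have [[r t] /[!inE] -[/rectP[rab ttt] zrt] tmin] :
    exists2 c : K * K, c \in N & forall x, x \in N -> c.2 <= x.2.
  apply: compact_EVT_min => //; first by exists x0.
  by apply: continuous_subspaceT => x; exact: cvg_snd.
rewrite /= in zrt tmin.
have tmin' s t' : a <= s <= b -> t0 <= t' < t -> 0 < z s t'.
  move=> sab t't; rewrite ltNge; apply/negP => zle.
  have : N (s, t') by split => //; apply/rectP; split => //; lra.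
  by move=> Ns; have := tmin (s, t'); rewrite inE => /(_ Ns) /=; lra.
have tt0 : t0 < t.
  rewrite lt_neqAle; case/andP: (ttt) => -> _; rewrite andbT.
  by apply/eqP => E; have := z0 r rab; rewrite E; lra.
have znneg s : a <= s <= b -> 0 <= z s t.
  move=> sab; rewrite leNgt; apply/negP => zneg.
  have [|k k0 H] := continuous2_uniform cz (e := - z s t / 2); first by lra.
  set m := Num.min (k / 2) (t - t0).
  have m0 : 0 < m by rewrite lt_min; apply/andP; split; lra.
  have [m1 m2] : m <= k / 2 /\ m <= t - t0 by rewrite !ge_min !lexx orbT.
  have := H s (t - m) s t sab _ sab ttt; rewrite subrr normr0 k0.
  rewrite addrAC subrr add0r normrN (gtr0_norm m0).
  have -> : t0 <= t - m <= t1 by lra.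
  have -> : m < k by lra.
  move=> /(_ isT isT isT); rewrite ltr_norml => /andP[H1 H2].
  have tm : t0 <= t - m < t by lra.
  by have := tmin' s (t - m) sab tm; lra.
exists r, t; split => //; first by lra.
by apply/eqP; rewrite eq_le zrt znneg.
Qed.

(** * Comparison principle for radial profiles *)

Lemma is_derive1_add (K : realType) (f g : K -> K) (x a b : K) :
  is_derive x 1 f a -> is_derive x 1 g b -> is_derive x 1 (fun y => f y + g y) (a + b).
Proof. exact: is_deriveD. Qed.

Lemma is_derive1_sub (K : realType) (f g : K -> K) (x a b : K) :
  is_derive x 1 f a -> is_derive x 1 g b -> is_derive x 1 (fun y => f y - g y) (a - b).
Proof. exact: is_deriveB. Qed.

Lemma is_derive1_mul (K : realType) (f g : K -> K) (x a b : K) :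
  is_derive x 1 f a -> is_derive x 1 g b ->
  is_derive x 1 (fun y => f y * g y) (f x * b + g x * a).
Proof. exact: is_deriveM. Qed.

Lemma is_derive1_cst (K : realType) (x c : K) : is_derive x 1 (fun=> c) 0.
Proof. exact: is_derive_cst. Qed.

Lemma is_derive1_id (K : realType) (x : K) : is_derive x 1 (fun y => y) 1.
Proof. exact: is_derive_id. Qed.

Lemma is_derive1_scale (K : realType) (f : K -> K) (c x a : K) :
  is_derive x 1 f a -> is_derive x 1 (fun y => c * f y) (c * a).
Proof.
move=> df; apply: is_derive_eq (is_derive1_mul (is_derive1_cst x c) df) _; ring.
Qed.

Lemma is_derive1_scaler (K : realType) (f : K -> K) (c x a : K) :
  is_derive x 1 f a -> is_derive x 1 (fun y => f y * c) (a * c).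
Proof.
move=> df; apply: is_derive_eq (is_derive1_mul df (is_derive1_cst x c)) _; ring.
Qed.

Lemma is_derive1_translate (K : realType) (f : K -> K) (c x a : K) :
  is_derive (x + c) 1 f a -> is_derive x 1 (fun y => f (y + c)) a.
Proof.
move=> df; have dg : is_derive x 1 (fun y => y + c) (1 + 0).
  exact: is_derive1_add (is_derive1_id x) (is_derive1_cst x c).
by have := @is_derive1_comp K f (fun y => y + c) x a (1 + 0) df dg; rewrite addr0 mulr1.
Qed.

Lemma is_derive1_exp_scale (K : realType) (L x : K) :
  is_derive x 1 (fun t => expR (L * t)) (L * expR (L * x)).
Proof.
have dg : is_derive x 1 (fun y => L * y) (L * 1).
  exact: is_derive1_scale (is_derive1_id x).
by have := @is_derive1_comp K expR (fun y => L * y) x _ _ (is_derive_expR (L * x)) dg;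
  rewrite mulr1 mulrC.
Qed.

Lemma is_derive1_continuous (K : realType) (f : K -> K) (x a : K) :
  is_derive x 1 f a -> {for x, continuous f}.
Proof. by move=> [df _]; apply: differentiable_continuous; apply/derivable1_diffP. Qed.

(** Convexity: the graph of [expR] lies above its tangent at [y]. *)
Lemma expR_sub_ge (K : realType) (x y : K) :
  expR y * (x - y) <= expR x - expR y.
Proof.
have := expR_ge1Dx (x - y); rewrite -(ler_pM2l (expR_gt0 y)) -expRD.
rewrite [in X in _ <= X]addrC subrK mulrDr mulr1; lra.
Qed.

(** By convexity the bound [M] is needed only at the larger point [y]. In a comparison it therefore
    has to control only the function that is supposed to lie below. *)
Lemma expR_reaction_ge (K : realType) (p M x y : K) : 0 <= p -> y <= M -> x <= y ->
  - (p * expR (p * M) * (y - x)) <= expR (p * x) - expR (p * y).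
Proof.
move=> p0 yM xy; apply: le_trans (expR_sub_ge _ _).
rewrite -mulrBr -[x - y]opprB mulrN mulrN lerN2 mulrCA mulrA.
apply: ler_wpM2r; first by rewrite subr_ge0.
by apply: ler_wpM2l => //; rewrite ler_expR; exact: ler_wpM2l.
Qed.

(* [U] on the rectangle [[r0, R] x [t0, t1]] with [V = U_t], [G = U_r] and
   [H = U_rr]; the parabolic boundary carries no derivatives, except that [G]
   is continuous up to [r = R]. *)
Record profile (K : realType) (r0 R t0 t1 : K) (U V G H : K -> K -> K) : Prop := {
  profile_continuous : continuous2 (rect r0 R t0 t1) U ;
  profile_dt : forall r t, r0 <= r < R -> t0 < t <= t1 -> is_derive t 1 (U r) (V r t) ;
  profile_dr : forall r t, r0 <= r < R -> t0 < t <= t1 -> is_derive r 1 (U ^~ t) (G r t) ;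
  profile_drr : forall r t, r0 <= r < R -> t0 < t <= t1 -> is_derive r 1 (G ^~ t) (H r t) ;
  profile_flux : forall t, t0 < t <= t1 -> G r t @[r --> R^'-] --> G R t
}.

Lemma profile_add (K : realType) (r0 R t0 t1 : K) (U1 V1 G1 H1 U2 V2 G2 H2 : K -> K -> K) :
  profile r0 R t0 t1 U1 V1 G1 H1 -> profile r0 R t0 t1 U2 V2 G2 H2 ->
  profile r0 R t0 t1 (fun r t => U1 r t + U2 r t) (fun r t => V1 r t + V2 r t)
    (fun r t => G1 r t + G2 r t) (fun r t => H1 r t + H2 r t).
Proof.
move=> [c1 t1' r1 rr1 f1] [c2 t2 r2 rr2 f2]; split.
- apply/subspace_continuousP => z Az; apply: cvgD.
  + by move/subspace_continuousP: c1; exact.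
  + by move/subspace_continuousP: c2; exact.
- by move=> r t hr ht; exact: is_derive1_add (t1' _ _ hr ht) (t2 _ _ hr ht).
- by move=> r t hr ht; exact: is_derive1_add (r1 _ _ hr ht) (r2 _ _ hr ht).
- by move=> r t hr ht; exact: is_derive1_add (rr1 _ _ hr ht) (rr2 _ _ hr ht).
- by move=> t ht; apply: cvgD; [exact: f1|exact: f2].
Qed.

Lemma profile_sub (K : realType) (r0 R t0 t1 : K) (U1 V1 G1 H1 U2 V2 G2 H2 : K -> K -> K) :
  profile r0 R t0 t1 U1 V1 G1 H1 -> profile r0 R t0 t1 U2 V2 G2 H2 ->
  profile r0 R t0 t1 (fun r t => U1 r t - U2 r t) (fun r t => V1 r t - V2 r t)
    (fun r t => G1 r t - G2 r t) (fun r t => H1 r t - H2 r t).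
Proof.
move=> [c1 t1' r1 rr1 f1] [c2 t2 r2 rr2 f2]; split.
- apply/subspace_continuousP => z Az; apply: cvgB.
  + by move/subspace_continuousP: c1; exact.
  + by move/subspace_continuousP: c2; exact.
- by move=> r t hr ht; exact: is_derive1_sub (t1' _ _ hr ht) (t2 _ _ hr ht).
- by move=> r t hr ht; exact: is_derive1_sub (r1 _ _ hr ht) (r2 _ _ hr ht).
- by move=> r t hr ht; exact: is_derive1_sub (rr1 _ _ hr ht) (rr2 _ _ hr ht).
- by move=> t ht; apply: cvgB; [exact: f1|exact: f2].
Qed.

(** Source of all explicit perturbations: an exponential in time multiplied by the barrier or by 1,
    and the constant shift [a * h]. *)
Lemma profile_separated (K : realType) (r0 R t0 t1 : K) (e e' f f' f'' : K -> K) :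
  (forall t : K, is_derive t 1 e (e' t)) -> (forall r : K, is_derive r 1 f (f' r)) ->
  (forall r : K, is_derive r 1 f' (f'' r)) ->
  profile r0 R t0 t1 (fun r t => e t * f r) (fun r t => e' t * f r)
    (fun r t => e t * f' r) (fun r t => e t * f'' r).
Proof.
move=> de df df'; split.
- apply: continuous_subspaceT => z; apply: cvgM.
  + by apply: continuous_comp; [exact: cvg_snd|exact: is_derive1_continuous (de _)].
  + by apply: continuous_comp; [exact: cvg_fst|exact: is_derive1_continuous (df _)].
- by move=> r t _ _; exact: is_derive1_scaler.
- by move=> r t _ _; exact: is_derive1_scale.
- by move=> r t _ _; exact: is_derive1_scale.
- move=> t _; apply: cvg_at_left_filter; apply: cvgM; first exact: cvg_cst.
  exact: is_derive1_continuous (df' _).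
Qed.

Lemma profile_translate (K : realType) (r0 R t0 t1 k h : K) (U V G H : K -> K -> K) :
  profile r0 R t0 t1 U V G H ->
  profile (r0 - k) (R - k) (t0 - h) (t1 - h) (fun r t => U (r + k) (t + h))
    (fun r t => V (r + k) (t + h)) (fun r t => G (r + k) (t + h))
    (fun r t => H (r + k) (t + h)).
Proof.
move=> [c dt dr drr fl]; split.
- apply: continuous2_of_eps => r t /rectP[hr ht] e e0.
  have [d d0 Hd] := continuous2_uniform c e0; exists d => // r' t' /rectP[hr' ht'] rr' tt'.
  have Er : r + k - (r' + k) = r - r' by ring.
  have Et : t + h - (t' + h) = t - t' by ring.
  by apply: Hd; rewrite ?Er ?Et //; lra.
- move=> r t hr ht; apply: is_derive1_translate; apply: dt; lra.
- move=> r t hr ht; apply: (@is_derive1_translate _ (U ^~ (t + h))); apply: dr; lra.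
- move=> r t hr ht; apply: (@is_derive1_translate _ (G ^~ (t + h))); apply: drr; lra.
- move=> t ht; have ht' : t0 < t + h <= t1 by lra.
  have /cvgrPdist_lt F := fl (t + h) ht'.
  apply/cvgrPdist_lt => e e0; have := F e e0.
  rewrite !near_withinE => /nbhs_ballP[d d0 Hd]; apply/nbhs_ballP; exists d => // r.
  rewrite /ball/= => Rr rR; rewrite subrK; apply: Hd => /=; last by lra.
  by rewrite /ball/=; have -> : R - (r + k) = R - k - r by ring.
Qed.

Lemma profileW (K : realType) (r0 R t0 t1 r0' t0' t1' : K) (U V G H : K -> K -> K) :
  r0 <= r0' -> t0 <= t0' -> t1' <= t1 ->
  profile r0 R t0 t1 U V G H -> profile r0' R t0' t1' U V G H.
Proof.
move=> hr ht0 ht1 [c dt dr drr fl]; split.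
- apply: continuous2W c => -[r t] /rectP[? ?]; apply/rectP; split; lra.
- by move=> r t ? ?; apply: dt; lra.
- by move=> r t ? ?; apply: dr; lra.
- by move=> r t ? ?; apply: drr; lra.
- by move=> t ?; apply: fl; lra.
Qed.

(** Maximum principle read at the first zero of [Z]. There [Z] has a spatial minimum and has just
    decreased to 0, so [Zt <= 0], which [int] forbids for [r < R]. At [r0] a minimum does not force
    [Zr = 0], so [left] supplies it; at [R] a positive [Zr] is incompatible with a minimum. *)
Lemma profile_positive (K : realType) (r0 R t0 t1 : K) (Z Zt Zr Zrr : K -> K -> K) :
  r0 < R -> profile r0 R t0 t1 Z Zt Zr Zrr ->
  (forall r, r0 <= r <= R -> 0 < Z r t0) ->
  (forall t, t0 < t <= t1 -> Z r0 t = 0 -> Zr r0 t = 0) ->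
  (forall t, t0 < t <= t1 -> Z R t = 0 -> 0 < Zr R t) ->
  (forall r t, r0 <= r < R -> t0 < t <= t1 -> Z r t = 0 -> Zr r t = 0 ->
     0 <= Zrr r t -> 0 < Zt r t) ->
  forall r t, r0 <= r <= R -> t0 <= t <= t1 -> 0 < Z r t.
Proof.
move=> r0R [cZ dt dr drr fl] init left right int.
have [//|[r [t [hr ht zrt zt zlt]]]] := first_zero cZ init.
exfalso.
have tt : t0 <= t <= t1 by lra.
(* No derivative of [Z] at [R] itself is available: [Zr] is positive on a left neighbourhood of [R]
   by continuity of the flux, and the mean value theorem gives a negative value of [Z] just
   inside. *)
have [rR|rR] := eqVneq r R.
  have := right t ht; rewrite -{1}rR => /(_ zrt) Zr0.
  have : \forall s \near R^'-, 0 < Zr s t by exact: cvgr_gt (fl t ht) _ Zr0.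
  rewrite near_withinE => /nbhs_ballP[d /= d0 Hd].
  set m := Num.min (d / 2) (R - r0).
  have m0 : 0 < m by rewrite lt_min; apply/andP; split; lra.
  have [m1 m2] : m <= d / 2 /\ m <= R - r0 by rewrite !ge_min !lexx orbT.
  have [|||s [hs E]] := @MVT_itv K (Z ^~ t) (Zr ^~ t) (R - m) R; first by lra.
  - apply: continuous_subspaceW (continuous2_section cZ tt) => s /=.
    rewrite !in_itv/=; lra.
  - by move=> s hs; apply: dr => //; lra.
  have := zt (R - m); rewrite -rR zrt in E *.
  have -> : r0 <= r - m <= r by lra.
  move=> /(_ isT) H1.
  have Zs : 0 < Zr s t.
    by apply: Hd; rewrite /ball/= ?ger0_norm; lra.
  have : 0 < Zr s t * (r - (r - m)) by apply: mulr_gt0 => //; lra.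
  lra.
have rR' : r < R by rewrite lt_neqAle rR; lra.
have hr' : r0 <= r < R by lra.
have Zr0 : Zr r t = 0.
  have [E|rr0] := eqVneq r r0; first by rewrite E; apply: left => //; rewrite -E.
  have rr0' : r0 < r by rewrite lt_neqAle eq_sym rr0; lra.
  apply/eqP; rewrite eq_le; apply/andP; split.
    by apply: (derive_left_le0 rr0' (dr _ _ hr' ht)) => s hs; rewrite zrt; apply: zt; lra.
  by apply: (derive_right_ge0 rR' (dr _ _ hr' ht)) => s hs; rewrite zrt; apply: zt; lra.
have Zrr0 : 0 <= Zrr r t.
  apply: (@second_derive_ge0 K (Z ^~ t) (Zr ^~ t) r R) => //.
  - by move=> s hs; apply: dr => //; lra.
  - exact: drr.
  - by move=> s hs; rewrite zrt; apply: zt; lra.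
have := int r t hr' ht zrt Zr0 Zrr0.
have tt0 : t0 < t by lra.
have := derive_left_le0 tt0 (dt _ _ hr' ht); rewrite zrt => H.
suff : Zt r t <= 0 by lra.
by apply: H => s hs; apply/ltW/zlt; lra.
Qed.

(* [g] and [h] are the first and second radial derivatives at [r] in dimension
   [nu]; as [r] tends to [0], [g / r] tends to [h]. *)
Definition rad_lap (K : realType) (nu r g h : K) : K :=
  if r == 0 then nu * h else h + (nu - 1) * (g / r).

Lemma rad_lapD (K : realType) (nu r g1 h1 g2 h2 : K) :
  rad_lap nu r (g1 + g2) (h1 + h2) = rad_lap nu r g1 h1 + rad_lap nu r g2 h2.
Proof. by rewrite /rad_lap; case: ifP => _; rewrite ?mulrDl; ring. Qed.

Lemma rad_lapB (K : realType) (nu r g1 h1 g2 h2 : K) :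
  rad_lap nu r (g1 - g2) (h1 - h2) = rad_lap nu r g1 h1 - rad_lap nu r g2 h2.
Proof. by rewrite /rad_lap; case: ifP => _; rewrite ?mulrBl; ring. Qed.

Lemma rad_lapZ (K : realType) (nu r c g h : K) :
  rad_lap nu r (c * g) (c * h) = c * rad_lap nu r g h.
Proof. by rewrite /rad_lap; case: ifP => _; rewrite -?mulrA; ring. Qed.

Lemma rad_lap_min (K : realType) (nu r h : K) : 1 <= nu -> 0 <= h ->
  0 <= rad_lap nu r 0 h.
Proof.
move=> nu1 h0; rewrite /rad_lap; case: ifP => _; last by rewrite mul0r mulr0 addr0.
by apply: mulr_ge0; lra.
Qed.

(* Its logarithmic derivative at [R] is [2 R / d], as large as needed to beat the
   linearized flux. *)
Definition barrier (K : realType) (R d r : K) : K :=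
  (r * r - (R * R - d)) * (r * r - (R * R - d)) + d * d.

Lemma is_derive_barrier (K : realType) (R d r : K) :
  is_derive r 1 (barrier R d) (4 * r * (r * r - (R * R - d))).
Proof.
have d1 : is_derive r 1 (fun x : K => x * x - (R * R - d)) (r * 1 + r * 1 - 0).
  exact: is_derive1_sub (is_derive1_mul (is_derive1_id r) (is_derive1_id r))
    (is_derive1_cst r _).
apply: is_derive_eq (is_derive1_add (is_derive1_mul d1 d1) (is_derive1_cst r (d * d))) _.
ring.
Qed.

Lemma is_derive2_barrier (K : realType) (R d r : K) :
  is_derive r 1 (fun r => 4 * r * (r * r - (R * R - d)))
    (12 * (r * r) - 4 * (R * R - d)).
Proof.
have d1 : is_derive r 1 (fun x : K => x * x - (R * R - d)) (r * 1 + r * 1 - 0).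
  exact: is_derive1_sub (is_derive1_mul (is_derive1_id r) (is_derive1_id r))
    (is_derive1_cst r _).
have d2 : is_derive r 1 (fun x : K => 4 * x) (4 * 1).
  exact: is_derive1_scale (is_derive1_id r).
apply: is_derive_eq (is_derive1_mul d2 d1) _.
ring.
Qed.

(** The linearized flux has the unfavourable sign: where [U1 < U2] it only gives
    [G1 - G2 >= - b (U2 - U1)] at [R]. The difference is therefore perturbed by [e * expR (L * t)]
    times a weight whose logarithmic derivative at [R] exceeds [b]; this makes every inequality of
    [profile_positive] strict, and [e] is then removed. *)
Lemma comparison (K : realType) (R p q lambda nu t0 t1 : K)
    (U1 V1 G1 H1 U2 V2 G2 H2 : K -> K -> K) :
  0 < R -> 0 < p -> 0 < q -> 0 < lambda -> 1 <= nu ->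
  profile 0 R t0 t1 U1 V1 G1 H1 -> profile 0 R t0 t1 U2 V2 G2 H2 ->
  (forall t, t0 < t <= t1 -> G1 0 t = 0) -> (forall t, t0 < t <= t1 -> G2 0 t = 0) ->
  (forall r t, 0 <= r < R -> t0 < t <= t1 ->
     rad_lap nu r (G1 r t) (H1 r t) + lambda * expR (p * U1 r t) <= V1 r t) ->
  (forall r t, 0 <= r < R -> t0 < t <= t1 ->
     V2 r t <= rad_lap nu r (G2 r t) (H2 r t) + lambda * expR (p * U2 r t)) ->
  (forall t, t0 < t <= t1 -> expR (q * U1 R t) <= G1 R t) ->
  (forall t, t0 < t <= t1 -> G2 R t <= expR (q * U2 R t)) ->
  (forall r, 0 <= r <= R -> U2 r t0 <= U1 r t0) ->
  forall r t, 0 <= r <= R -> t0 <= t <= t1 -> U2 r t <= U1 r t.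
Proof.
move=> R0 p0 q0 la0 nu1 P1 P2 G10 G20 super sub flux1 flux2 init r t hr ht.
have [M M0 HM] := continuous2_bounded (profile_continuous P2).
set b := q * expR (q * M).
have b0 : 0 < b by apply: mulr_gt0 => //; exact: expR_gt0.
(* Makes the logarithmic derivative of the barrier at [R] equal to [2 * b], twice the Lipschitz
   constant of the flux below [M]. *)
set d := R / b; have d0 : 0 < d by exact: divr_gt0.
set c0 := lambda * (p * expR (p * M)).
have c00 : 0 < c0 by rewrite !mulr_gt0 // expR_gt0.
set c := R * R - d.
set B := 12 * (R * R) + 4 * `|c| + nu * (4 * (R * R + `|c|)).
(* [B] bounds the Laplacian of the barrier and [d * d] bounds the barrier from below, so the first
   term dominates that Laplacian, strictly thanks to [+ 1]; [c0] absorbs the linearized reaction. *)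
set L := (B + 1) / (d * d) + c0.
have phid s : d * d <= barrier R d s.
  by rewrite /barrier lerDr -expr2 sqr_ge0.
have phi0 s : 0 < barrier R d s by apply: lt_le_trans (phid s); exact: mulr_gt0.
have phiR : b * barrier R d R < 4 * R * (R * R - (R * R - d)).
  rewrite /barrier; have E : b * d = R by rewrite /d mulrC divfK // gt_eqF.
  have -> : b * ((R * R - (R * R - d)) * (R * R - (R * R - d)) + d * d)
     = 2 * (b * d) * d by ring.
  rewrite E; have : 0 < R * d by exact: mulr_gt0.
  lra.
(* The barrier is a function of [r * r], so its first derivative is divisible by [r] and the
   singular term of the Laplacian stays bounded up to the centre. *)
have lapB s : 0 <= s < R ->
    rad_lap nu s (4 * s * (s * s - c)) (12 * (s * s) - 4 * c) <= B.
  move=> hs; have ss : s * s <= R * R by apply: ler_pM; lra.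
  have c1 : - c <= `|c| by rewrite -normrN ler_norm.
  have ss0 : 0 <= s * s by apply: mulr_ge0; lra.
  have RR : 0 <= R * R by apply: mulr_ge0; lra.
  rewrite /rad_lap; case: ifPn => [/eqP -> | s0].
    have : nu * (12 * (0 * 0) - 4 * c) <= nu * (4 * (R * R + `|c|)).
      apply: ler_wpM2l; lra.
    rewrite /B; have := normr_ge0 c; lra.
  have -> : 4 * s * (s * s - c) / s = 4 * (s * s - c) by field.
  have : (nu - 1) * (4 * (s * s - c)) <= (nu - 1) * (4 * (R * R + `|c|)).
    by apply: ler_wpM2l; lra.
  have : 0 <= 4 * (R * R + `|c|) by have := normr_ge0 c; lra.
  rewrite /B; lra.
have Lphi s : 0 <= s < R ->
    rad_lap nu s (4 * s * (s * s - c)) (12 * (s * s) - 4 * c) + c0 * barrier R d s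
    < L * barrier R d s.
  move=> hs; have B0 : 0 <= B.
    have RR : 0 <= R * R by rewrite mulr_ge0 // ltW.
    have := normr_ge0 c; have : 0 <= nu * (4 * (R * R + `|c|)).
      by apply: mulr_ge0; have := normr_ge0 c; lra.
    rewrite /B; lra.
  have := lapB s hs; rewrite /L mulrDl.
  have : (B + 1) / (d * d) * (d * d) <= (B + 1) / (d * d) * barrier R d s.
    by apply: ler_wpM2l => //; apply: divr_ge0; [lra|rewrite mulr_ge0 // ltW].
  rewrite divfK; first by lra.
  by rewrite mulf_neq0 // gt_eqF.
(* If [U1 < U2] at the point, the choice [e = (U2 - U1) / g] makes the perturbed difference vanish
   exactly, which contradicts its positivity. *)
suff H e : 0 < e -> 0 < U1 r t - U2 r t + e * expR (L * t) * barrier R d r.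
  rewrite -subr_ge0 leNgt; apply/negP => neg.
  set g := expR (L * t) * barrier R d r.
  have g0 : 0 < g by rewrite mulr_gt0 // expR_gt0.
  have := H (- (U1 r t - U2 r t) / g); rewrite divr_gt0 // ?oppr_gt0 //.
  rewrite -[_ * expR _ * _]mulrA -/g divfK ?gt_eqF // => /(_ isT); lra.
move=> e0.
have P3 := profile_separated 0 R t0 t1 (fun t => is_derive1_scale e (is_derive1_exp_scale L t))
  (is_derive_barrier R d) (is_derive2_barrier R d).
have P := profile_add (profile_sub P1 P2) P3.
have et s : 0 < e * expR (L * s) by rewrite mulr_gt0 // expR_gt0.
apply: (profile_positive R0 P) => //= {r t hr ht}.
- move=> r hr; have := init r hr; have := mulr_gt0 (et t0) (phi0 r); lra.
- by move=> t ht _; rewrite G10 // G20 //; ring.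
- move=> t ht; set ps := _ * barrier R d R => E.
  have ps0 : 0 < ps by exact: mulr_gt0.
  have E1 : U2 R t - U1 R t = ps by clear - E; lra.
  have UM : U2 R t <= M.
    by apply: le_trans (ler_norm _) _; apply: HM; clear - R0 ht; lra.
  have U12 : U1 R t <= U2 R t by rewrite -subr_ge0 E1 ltW.
  have := expR_reaction_ge (ltW q0) UM U12; rewrite E1 -/b.
  have f1 := flux1 t ht; have f2 := flux2 t ht.
  have : b * ps < e * expR (L * t) * (4 * R * (R * R - (R * R - d))).
    by rewrite /ps mulrCA ltr_pM2l.
  clear - f1 f2; lra.
- move=> r t hr ht; set ps := _ * barrier R d r => E Er Err.
  have ps0 : 0 < ps by exact: mulr_gt0.
  have E1 : U2 r t - U1 r t = ps by clear - E; lra.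
  have UM : U2 r t <= M.
    by apply: le_trans (ler_norm _) _; apply: HM; clear - hr ht; lra.
  have U12 : U1 r t <= U2 r t by rewrite -subr_ge0 E1 ltW.
  have := ler_wpM2l (ltW la0) (expR_reaction_ge (ltW p0) UM U12); rewrite E1.
  have -> : lambda * - (p * expR (p * M) * ps) = - (c0 * ps) by rewrite /c0; ring.
  rewrite mulrBr => reaction.
  have sup := super r t hr ht; have sb := sub r t hr ht.
  have := rad_lap_min r nu1 Err; rewrite -{2}Er rad_lapD rad_lapB rad_lapZ -/c => lap.
  have := Lphi r hr; rewrite -(ltr_pM2l (et t)).
  have -> : e * expR (L * t) * (L * barrier R d r) = e * (L * expR (L * t)) * barrier R d r.
    by ring.
  rewrite mulrDr; have -> : e * expR (L * t) * (c0 * barrier R d r) = c0 * ps.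
    by rewrite /ps; ring.
  clear - reaction sup sb lap; lra.
Qed.

(** * Radial flows *)

(** At an interior right end [R'] the flux limit comes from the differentiability of [G], not from
    the boundary condition at [R]. *)
Lemma profile_shrink (K : realType) (r0 R R' t0 t1 : K) (U V G H : K -> K -> K) :
  r0 <= R' < R -> profile r0 R t0 t1 U V G H -> profile r0 R' t0 t1 U V G H.
Proof.
move=> rR [c dt dr drr fl]; split.
- apply: continuous2W c => -[r t] /rectP[? ?]; apply/rectP; split; lra.
- by move=> r t ? ?; apply: dt; lra.
- by move=> r t ? ?; apply: dr; lra.
- by move=> r t ? ?; apply: drr; lra.
- move=> t ht; apply: cvg_at_left_filter.
  exact: is_derive1_continuous (drr _ _ rR ht).
Qed.

Lemma profile_delay (K : realType) (r0 R t0 t1 h : K) (U V G H : K -> K -> K) :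
  profile r0 R (t0 + h) (t1 + h) U V G H ->
  profile r0 R t0 t1 (fun r t => U r (t + h)) (fun r t => V r (t + h))
    (fun r t => G r (t + h)) (fun r t => H r (t + h)).
Proof.
move=> /(profile_translate 0 h); rewrite !subr0 !addrK.
have E (f : K -> K -> K) : (fun r t => f (r + 0) (t + h)) = (fun r t => f r (t + h)).
  by apply/funext => r; rewrite addr0.
by rewrite !E.
Qed.

Lemma profile_stationary (K : realType) (R t0 t1 a : K) (f f' f'' : K -> K) :
  {within `[0, R], continuous f} ->
  (forall r, 0 <= r < R -> is_derive r 1 f (f' r)) ->
  (forall r, 0 <= r < R -> is_derive r 1 f' (f'' r)) ->
  f' r @[r --> R^'-] --> f' R ->
  profile 0 R t0 t1 (fun r t => f r + a * t) (fun _ _ => a) (fun r _ => f' r)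
    (fun r _ => f'' r).
Proof.
move=> cf df df' fl; split.
- apply/subspace_continuousP => -[r t] /rectP[hr ht]; apply: cvgD; last first.
    by apply: cvgM; [exact: cvg_cst|apply: cvg_within_filter; exact: cvg_snd].
  apply/cvgrPdist_lt => e e0; rewrite near_withinE.
  have rI : `[0, R]%classic r by rewrite /= in_itv.
  have [d d0 Hd] := within_continuous_eps cf rI e0.
  apply/nbhs_ballP; exists d => // -[r' t'] /ball_pairE[/= rr' _] /rectP[hr' _].
  by rewrite distrC; apply: Hd => //=; rewrite in_itv.
- move=> r t _ _; apply: is_derive_eq (is_derive1_add (is_derive1_cst t (f r))
    (is_derive1_scale a (is_derive1_id t))) _.
  by rewrite add0r mulr1.
- move=> r t hr _; apply: is_derive_eq (is_derive1_add (df r hr)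
    (is_derive1_cst r (a * t))) _.
  by rewrite addr0.
- by move=> r t hr _; exact: df'.
- by [].
Qed.

(** The equation and the time derivative are available only for [r < R]; inequalities between
    boundary values are obtained inside and carried to [R] by this lemma. *)
Lemma endpoint_ge (K : realType) (R d c : K) (f : K -> K) : 0 < R -> 0 < d ->
  {within `[0, R], continuous f} ->
  (forall r, 0 < r < R -> R - d < r -> c <= f r) -> c <= f R.
Proof.
move=> R0 d0 cf Hc; rewrite leNgt; apply/negP => fc.
have RI : `[0, R]%classic R by rewrite /= in_itv/= lexx ltW.
have cf0 : 0 < c - f R by lra.
have [k k0 Hk] := within_continuous_eps cf RI cf0.
set m := Num.min (Num.min (d / 2) (k / 2)) (R / 2).
have m0 : 0 < m by rewrite !lt_min; apply/andP; split; [apply/andP; split|]; lra.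
have [m1 m2 m3] : [/\ m <= d / 2, m <= k / 2 & m <= R / 2].
  by rewrite !ge_min !lexx !orbT.
have /Hk : `[0, R]%classic (R - m) by rewrite /= in_itv/=; lra.
rewrite /ball/= opprB addrC subrK gtr0_norm // => X.
have : `|f (R - m) - f R| < c - f R by apply: X; lra.
rewrite ltr_norml => /andP[_ {}X].
have Y : c <= f (R - m) by apply: Hc; lra.
lra.
Qed.

(** Everything that the estimates use about the solution, with the dimension as a real [nu]. The
    derivatives are continuous up to [r = R] only on rectangles away from [t = 0], whereas [U] is
    continuous down to [t = 0]. At [r = R] the values of [V], [G] and [H] are limits from inside,
    not asserted derivatives. *)
Record radial_flow (K : realType) (R p q lambda nu T : K)
    (U V G H : K -> K -> K) : Prop := {
  flow_profile : forall t1, t1 < T -> profile 0 R 0 t1 U V G H ;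
  flow_continuous_dt : forall t0 t1, 0 < t0 -> t1 < T ->
    continuous2 (rect 0 R t0 t1) V ;
  flow_continuous_dr : forall t0 t1, 0 < t0 -> t1 < T ->
    continuous2 (rect 0 R t0 t1) G ;
  flow_continuous_drr : forall t0 t1, 0 < t0 -> t1 < T ->
    continuous2 (rect 0 R t0 t1) H ;
  flow_center : forall t, 0 < t < T -> G 0 t = 0 ;
  flow_pde : forall r t, 0 <= r < R -> 0 < t < T ->
    V r t = rad_lap nu r (G r t) (H r t) + lambda * expR (p * U r t) ;
  flow_flux : forall t, 0 < t < T -> G R t = expR (q * U R t)
}.

Lemma flow_dr (K : realType) (R p q lambda nu T : K) (U V G H : K -> K -> K) :
  radial_flow R p q lambda nu T U V G H ->
  forall x y t, 0 <= x < y -> y <= R -> 0 < t < T ->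
  exists2 s, x < s < y & U y t - U x t = G s t * (y - x).
Proof.
move=> S x y t hx hy ht.
have tT : (t + T) / 2 < T by lra.
have P := flow_profile S tT.
have [|||s [hs E]] := @MVT_itv K (U ^~ t) (G ^~ t) x y; last by exists s.
- by lra.
- have ht' : 0 <= t <= (t + T) / 2 by lra.
  apply: continuous_subspaceW (continuous2_section (profile_continuous P) ht') => s /=.
  rewrite !in_itv/=; lra.
- by move=> s hs; apply: (profile_dr P); lra.
Qed.

Lemma flow_drr (K : realType) (R p q lambda nu T : K) (U V G H : K -> K -> K) :
  radial_flow R p q lambda nu T U V G H ->
  forall x y t, 0 <= x < y -> y <= R -> 0 < t < T ->
  exists2 s, x < s < y & G y t - G x t = H s t * (y - x).
Proof.
move=> S x y t hx hy ht.
have tT : (t + T) / 2 < T by lra.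
have P := flow_profile S tT.
have [|||s [hs E]] := @MVT_itv K (G ^~ t) (H ^~ t) x y; last by exists s.
- by lra.
- have t0 : 0 < t by lra.
  have ht' : t <= t <= (t + T) / 2 by lra.
  apply: continuous_subspaceW (continuous2_section (flow_continuous_dr S t0 tT) ht') => s /=.
  rewrite !in_itv/=; lra.
- by move=> s hs; apply: (profile_drr P); lra.
Qed.

(** [f + a t] is a subsolution: its time derivative [a] is at most the right-hand side for [f], and
    adding [a t >= 0] only increases the reaction and the prescribed flux. *)
Lemma flow_above_initial (K : realType) (R p q lambda nu T a : K)
    (U V G H : K -> K -> K) (f f' f'' : K -> K) :
  0 < R -> 0 < p -> 0 < q -> 0 < lambda -> 1 <= nu -> 0 < a ->
  radial_flow R p q lambda nu T U V G H ->
  {within `[0, R], continuous f} ->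
  (forall r, 0 <= r < R -> is_derive r 1 f (f' r)) ->
  (forall r, 0 <= r < R -> is_derive r 1 f' (f'' r)) ->
  f' r @[r --> R^'-] --> f' R -> f' 0 = 0 -> f' R = expR (q * f R) ->
  (forall r, 0 <= r < R -> a <= rad_lap nu r (f' r) (f'' r) + lambda * expR (p * f r)) ->
  (forall r, 0 <= r <= R -> U r 0 = f r) ->
  forall r t, 0 <= r <= R -> 0 <= t < T -> U r 0 + a * t <= U r t.
Proof.
move=> R0 p0 q0 la0 nu1 a0 S cf df df' fl f'0 f'R sub init r t hr ht.
have tT : (t + T) / 2 < T by lra.
have ht1 : 0 <= t <= (t + T) / 2 by lra.
have := comparison R0 p0 q0 la0 nu1 (flow_profile S tT)
  (profile_stationary 0 ((t + T) / 2) a cf df df' fl) _ _ _ _ _ _ _ hr ht1.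
rewrite /= init //; apply => {r hr ht1} //.
- by move=> s hs; apply: (flow_center S); lra.
- by move=> r s hr hs; rewrite (flow_pde S) //; lra.
- move=> r s hr hs; apply: le_trans (sub r hr) _.
  rewrite lerD2l ler_pM2l // ler_expR ler_pM2l // lerDl mulr_ge0 //; lra.
- by move=> s hs; rewrite (flow_flux S) //; lra.
- move=> s hs; rewrite f'R ler_expR ler_pM2l // lerDl mulr_ge0 //; lra.
- by move=> r hr; rewrite mulr0 addr0 init.
Qed.

(** The problem is autonomous, so the delayed flow is again a solution, while [U + a * h] is a
    subsolution by monotonicity of the exponentials. They are ordered at time 0 by the bound from
    below at time [h]. *)
Lemma flow_increment_ge (K : realType) (R p q lambda nu T a : K)
    (U V G H : K -> K -> K) :
  0 < R -> 0 < p -> 0 < q -> 0 < lambda -> 1 <= nu -> 0 < a ->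
  radial_flow R p q lambda nu T U V G H ->
  (forall r t, 0 <= r <= R -> 0 <= t < T -> U r 0 + a * t <= U r t) ->
  forall r t h, 0 <= r <= R -> 0 <= t -> 0 <= h -> t + h < T ->
    U r t + a * h <= U r (t + h).
Proof.
move=> R0 p0 q0 la0 nu1 a0 S init r t h hr t0 h0 th.
have P1 : profile 0 R 0 t (fun r t => U r (t + h)) (fun r t => V r (t + h))
    (fun r t => G r (t + h)) (fun r t => H r (t + h)).
  by apply: profile_delay; apply: profileW (flow_profile S th); lra.
have tT : t < T by lra.
have de (s : K) : is_derive s 1 (fun _ : K => 1 : K) 0 by exact: is_derive1_cst.
have d0 (s : K) : is_derive s 1 (fun _ : K => 0 : K) 0 by exact: is_derive1_cst.
have dah (s : K) : is_derive s 1 (fun _ : K => a * h) 0 by exact: is_derive1_cst.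
have P2 := profile_add (flow_profile S tT) (profile_separated 0 R 0 t dah de d0).
have htt : 0 <= t <= t by lra.
have := comparison R0 p0 q0 la0 nu1 P1 P2 _ _ _ _ _ _ _ hr htt.
rewrite /= !mulr1; apply => {r hr htt P1 P2} //.
- by move=> s hs; apply: (flow_center S); lra.
- by move=> s hs; rewrite (flow_center S) ?mulr0 ?addr0 //; lra.
- by move=> r s hr hs; rewrite (flow_pde S) //; lra.
- move=> r s hr hs; rewrite !mulr0 !addr0 (flow_pde S) //; last by lra.
  rewrite lerD2l ler_pM2l // ler_expR ler_pM2l // lerDl mulr_ge0 //; lra.
- by move=> s hs; rewrite (flow_flux S) //; lra.
- move=> s hs; rewrite mulr0 addr0 (flow_flux S); last by lra.
  rewrite ler_expR ler_pM2l // lerDl mulr_ge0 //; lra.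
- by move=> r hr; rewrite add0r; apply: init; lra.
Qed.

Lemma flow_dt_ge (K : realType) (R p q lambda nu T a : K)
    (U V G H : K -> K -> K) : 0 < R ->
  radial_flow R p q lambda nu T U V G H ->
  (forall r t h, 0 <= r <= R -> 0 <= t -> 0 <= h -> t + h < T ->
    U r t + a * h <= U r (t + h)) ->
  forall t, 0 < t < T -> a <= V R t.
Proof.
move=> R0 S incr t ht.
have t0 : 0 < t by lra.
have tT : (t + T) / 2 < T by lra.
have ht' : t <= t <= (t + T) / 2 by lra.
apply: (@endpoint_ge K R 1 a (V ^~ t) R0 ltr01
  (continuous2_section (flow_continuous_dt S t0 tT) ht')) => r hr _.
rewrite -subr_ge0.
have hr' : 0 <= r < R by lra.
have ht2 : 0 < t <= (t + T) / 2 by lra.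
have D := is_derive1_sub (profile_dt (flow_profile S tT) hr' ht2)
  (is_derive1_scale a (is_derive1_id t)).
have tt : t < (t + T) / 2 by lra.
have := derive_right_ge0 tt D; rewrite mulr1; apply => s hs.
have := incr r t (s - t); rewrite addrCA subrr addr0 => incr_rt.
have : U r t + a * (s - t) <= U r s by apply: incr_rt; lra.
rewrite mulrBr; lra.
Qed.

(** [U R] is not known to be differentiable in time, so the mean value theorem is applied for [r]
    just below [R], with [V] frozen at [(R, t + h)] up to [e], before passing to [R]. *)
Lemma flow_dt_end (K : realType) (R p q lambda nu T : K)
    (U V G H : K -> K -> K) (t h k e : K) : 0 < R ->
  radial_flow R p q lambda nu T U V G H ->
  0 < t -> 0 < h -> t + h < T -> 0 < k ->
  (forall r s, 0 <= r <= R -> R - k < r -> t <= s <= t + h ->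
    `|V r s - V R (t + h)| < e) ->
  (V R (t + h) - e) * h <= U R (t + h) - U R t.
Proof.
move=> R0 S t0 h0 th k0 HV.
have P := flow_profile S th.
have h1 : 0 <= t + h <= t + h by lra.
have h2 : 0 <= t <= t + h by lra.
apply: (@endpoint_ge K R k _ (fun r => U r (t + h) - U r t) R0 k0) => [|r hr rk].
  apply/subspace_continuousP => z Az; apply: cvgB.
  - by have /subspace_continuousP := continuous2_section (profile_continuous P) h1; exact.
  - by have /subspace_continuousP := continuous2_section (profile_continuous P) h2; exact.
have [|||s [hs E]] := @MVT_itv K (U r) (V r) t (t + h).
- lra.
- apply: derivable_within_continuous => s; rewrite in_itv/= => hs.
  have hr' : 0 <= r < R by lra.
  have hs' : 0 < s <= t + h by lra.
  by have [] := profile_dt P hr' hs'.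
- move=> s hs; apply: (profile_dt P); lra.
rewrite E addrAC subrr add0r ler_pM2r //.
have : `|V r s - V R (t + h)| < e by apply: HV; lra.
rewrite ltr_norml; lra.
Qed.

(** Near [R] the flux condition makes [G] positive, so the equation writes [V - H] as a sum of
    nonnegative terms, [(nu - 1) * (G / r)] and the reaction; the inequality passes to [R] by
    continuity. *)
Lemma flow_drr_le_dt (K : realType) (R p q lambda nu T : K)
    (U V G H : K -> K -> K) : 0 < R -> 0 < lambda -> 1 <= nu ->
  radial_flow R p q lambda nu T U V G H ->
  forall t, 0 < t < T -> H R t <= V R t.
Proof.
move=> R0 la0 nu1 S t ht.
have t0 : 0 < t by lra.
have tT : (t + T) / 2 < T by lra.
have ht' : t <= t <= (t + T) / 2 by lra.
have G0 : 0 < G R t by rewrite (flow_flux S ht) expR_gt0.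
have [d d0 Hd] := continuous2_uniform (flow_continuous_dr S t0 tT) G0.
rewrite -subr_ge0.
apply: (@endpoint_ge K R d _ (fun r => V r t - H r t) R0 d0) => [|r hr rd].
  apply/subspace_continuousP => z Az; apply: cvgB.
  - by have /subspace_continuousP := continuous2_section (flow_continuous_dt S t0 tT) ht'; exact.
  - by have /subspace_continuousP := continuous2_section (flow_continuous_drr S t0 tT) ht'; exact.
have Gr : 0 < G r t.
  have : `|G R t - G r t| < G R t.
    apply: Hd; rewrite ?subrr ?normr0 //; try lra.
    rewrite gtr0_norm; lra.
  rewrite ltr_norml; lra.
rewrite (flow_pde S) //; last by lra.
rewrite /rad_lap gt_eqF; last by lra.
have : 0 <= (nu - 1) * (G r t / r).
  by apply: mulr_ge0; [lra|apply: divr_ge0; lra].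
have : 0 < lambda * expR (p * U r t) by rewrite mulr_gt0 // expR_gt0.
lra.
Qed.

(** * The two-point comparison and the resulting rate *)

Lemma rad_lap_shift (K : realType) (nu r k g h h' : K) : 1 <= nu -> 0 < k < r ->
  0 <= g -> h <= h' -> rad_lap nu r g h <= rad_lap nu (r - k) g h'.
Proof.
move=> nu1 /andP[k0 kr] g0 hh'.
rewrite /rad_lap !gt_eqF ?subr_gt0 //; last by lra.
apply: lerD => //; apply: ler_wpM2l; first by lra.
by apply: ler_wpM2l => //; rewrite lef_pV2 ?posrE ?subr_gt0 //; lra.
Qed.

(** Strict flux inequality for the two-point function at [R]. Over the step [h], the boundary flux
    [expR (q * U)] gains at least [q (V - a/4) h], using [U >= 0]. Moving inwards by [k] loses at
    most [(V + a/4) k], since [H <= V] at [R], and [k <= q h / 2]. The balance is at least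
    [(4 V - 3 a) q h / 8], positive because [V >= a]. *)
Lemma flow_flux_gain (K : realType) (R p q lambda nu T a s h k : K)
    (U V G H : K -> K -> K) :
  0 < R -> 0 < q -> 0 < lambda -> 1 <= nu -> 0 < a ->
  radial_flow R p q lambda nu T U V G H ->
  (forall r t h, 0 <= r <= R -> 0 <= t -> 0 <= h -> t + h < T ->
    U r t + a * h <= U r (t + h)) ->
  (forall r t, 0 <= r <= R -> 0 <= t < T -> 0 <= U r t) ->
  0 < s -> 0 < h -> s + h < T -> 0 < k < R -> k <= q / 2 * h ->
  (forall r t, 0 <= r <= R -> R - k < r -> s <= t <= s + h ->
    `|V r t - V R (s + h)| < a / 4) ->
  (forall r, R - k <= r <= R -> `|H r (s + h) - H R (s + h)| < a / 4) ->
  G R s < G (R - k) (s + h).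
Proof.
move=> R0 q0 la0 nu1 a0 S incr Uge0 s0 h0 sh /andP[k0 kR] kh cV cH.
have sh0 : 0 < s + h < T by rewrite addr_gt0.
have aV := flow_dt_ge R0 S incr sh0.
have inc := flow_dt_end R0 S s0 h0 sh k0 cV.
have HV := flow_drr_le_dt R0 la0 nu1 S sh0.
have [|||rho hrho E] := flow_drr S (x := R - k) (y := R) (t := s + h) => //.
  by rewrite subr_ge0 (ltW kR) ltrBlDr ltrDl.
have /ltr_normlP[_ Hrho] : `|H rho (s + h) - H R (s + h)| < a / 4.
  by apply: cH; case/andP: hrho => /ltW -> /ltW.
have exp_gain : q * (U R (s + h) - U R s) <= G R (s + h) - G R s.
  have RR : 0 <= R <= R by rewrite lexx ltW.
  have sT : 0 < s < T by rewrite s0; lra.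
  rewrite !(flow_flux S) //; apply: le_trans (expR_sub_ge _ _); rewrite -mulrBr.
  have X : 1 <= expR (q * U R s).
    by rewrite -expR0 ler_expR mulr_ge0 ?(ltW q0) ?Uge0 //; case/andP: sT => /ltW ->.
  rewrite ler_peMl // mulr_ge0 ?(ltW q0) //; apply: le_trans inc.
  by rewrite mulr_ge0 ?(ltW h0) //; lra.
rewrite subKr in E.
have q_inc := ler_wpM2l (ltW q0) inc.
have H_k : H rho (s + h) * k <= (V R (s + h) + a / 4) * (q / 2 * h).
  apply: le_trans (_ : (V R (s + h) + a / 4) * k <= _).
    by rewrite ler_pM2r //; lra.
  by rewrite ler_wpM2l //; lra.
have : 0 < (V R (s + h) * 4 - a * 3) * (q * h) / 8.
  by rewrite divr_gt0 // mulr_gt0 ?mulr_gt0 //; lra.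
have : q * ((V R (s + h) - a / 4) * h) =
  (V R (s + h) + a / 4) * (q / 2 * h) + (V R (s + h) * 4 - a * 3) * (q * h) / 8.
  by field.
clear - exp_gain E q_inc H_k; lra.
Qed.

(** The growth in time and the hypothesis on [U (r - k) (t + h)] give
    [U r t - U (r - k) t >= a * h = b * k]. So the slope at some intermediate point is at least [b],
    and [G r t] differs from it by less than [b]. *)
Lemma flow_dr_gt0 (K : realType) (R p q lambda nu T a r t h k b : K)
    (U V G H : K -> K -> K) :
  radial_flow R p q lambda nu T U V G H ->
  (forall r t h, 0 <= r <= R -> 0 <= t -> 0 <= h -> t + h < T ->
    U r t + a * h <= U r (t + h)) ->
  0 < t -> 0 < h -> t + h < T -> 0 < k <= r -> r <= R -> b * k = a * h ->
  U (r - k) (t + h) <= U r t -> (forall s, r - k < s < r -> `|G s t - G r t| < b) ->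
  0 < G r t.
Proof.
move=> S incr t0 h0 th /andP[k0 kr] rR bk Uk cG.
have tT : 0 < t < T by rewrite t0; lra.
have [|||s hs E] := flow_dr S (x := r - k) (y := r) (t := t) => //.
  by rewrite subr_ge0 kr ltrBlDr ltrDl.
have rk : 0 <= r - k <= R by lra.
have I := incr (r - k) t h rk (ltW t0) (ltW h0) th.
have /ltr_normlP[_ Gs] := cG s hs.
rewrite subKr in E.
have : b * k <= G s t * k by lra.
rewrite ler_pM2r //; lra.
Qed.

(* Maximum principle for [U (r - k) (t + h) - U r t]. Shifting the singular
   coefficient from [1/r] to [1/(r-k)] helps where [U_r >= 0], and this holds
   where the function could vanish: there [U r t - U (r - k) t >= a h]. *)
Lemma flow_two_point (K : realType) (R p q lambda nu T a eps t0 T1 T2 h k : K)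
    (U V G H : K -> K -> K) :
  0 < R -> 0 < p -> 0 < q -> 0 < lambda -> 1 <= nu -> 0 < a ->
  radial_flow R p q lambda nu T U V G H ->
  (forall r t h, 0 <= r <= R -> 0 <= t -> 0 <= h -> t + h < T ->
    U r t + a * h <= U r (t + h)) ->
  (forall r t, 0 <= r <= R -> 0 <= t < T -> 0 <= U r t) ->
  0 < t0 -> t0 <= T1 -> T1 + h <= T2 -> T2 < T -> 0 < h -> 0 < eps -> k = eps * h ->
  k < R -> eps <= q / 2 ->
  (forall r, 0 <= r <= R -> eps * G r t0 < a) ->
  (forall r t s, 0 <= r <= R -> R - k < r -> t0 <= t -> t + h <= T2 ->
    t <= s <= t + h -> `|V r s - V R (t + h)| < a / 4) ->
  (forall r t, R - k <= r <= R -> t0 <= t <= T2 -> `|H r t - H R t| < a / 4) ->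
  (forall r s t, 0 <= r <= s -> s <= R -> s - r <= k -> t0 <= t <= T2 ->
     `|G r t - G s t| < a / eps) ->
  forall t, t0 <= t <= T1 -> U R t <= U (R - k) (t + h).
Proof.
move=> R0 p0 q0 la0 nu1 a0 S incr Uge0 t00 t01 T12 T2T h0 e0 kE kR eq Gt0 cV cH cG t ht.
have k0 : 0 < k by rewrite kE mulr_gt0.
have akE : a / eps * k = a * h by rewrite kE; field; rewrite gt_eqF.
have kh : k <= q / 2 * h by rewrite kE ler_pM2r.
have kG0 r : 0 <= r <= R -> G r t0 * k < a * h.
  by move=> hr; rewrite kE mulrA [G r t0 * _]mulrC ltr_pM2r //; exact: Gt0.
clear kE eq Gt0.
have time s : t0 <= s <= T1 -> [/\ 0 < s, 0 < s < T, s + h < T, t0 <= s <= T2 & t0 <= s + h <= T2].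
  clear - t00 T12 T2T h0; move=> ?; split; lra.
have gain s : t0 <= s <= T1 -> G R s < G (R - k) (s + h).
  move=> /time[s0 _ sh hs hsh].
  have kkR : 0 < k < R by rewrite k0.
  apply: (flow_flux_gain R0 q0 la0 nu1 a0 S incr Uge0 s0 h0 sh kkR kh).
    move=> r t' hr rk ht'; by apply: cV => //; [case/andP: hs|case/andP: hsh].
  by move=> r hr; exact: cH.
(* Going from [r - k] to [r] at time [t0] raises [U] by less than [a * h], by the smallness of
   [eps * G] at [t0]; going from [t0] to [t0 + h] raises it by at least [a * h]. *)
have init r : k <= r <= R -> 0 < U (r - k) (t0 + h) - U r t0.
  move=> /andP[kr rR].
  have hk : 0 <= r - k < r by rewrite subr_ge0 kr ltrBlDr ltrDl.
  have tt : t0 <= t0 <= T1 by rewrite lexx.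
  have [_ tT th _ _] := time t0 tt.
  have [s hs E] := flow_dr S hk rR tT.
  have hs' : 0 <= s <= R by clear - hk hs rR; lra.
  have rk : 0 <= r - k <= R by clear - hk rR; lra.
  have I := incr _ _ _ rk (ltW t00) (ltW h0) th.
  have Gk := kG0 s hs'; move: E; rewrite subKr.
  clear - I Gk; lra.
(* The inner point is now the centre, where [G = 0]. The modulus of continuity keeps [G] below
   [a / eps] on [[0, k]], so [U k s - U 0 s < a * h]. *)
have left s : t0 <= s <= T1 -> 0 < U (k - k) (s + h) - U k s.
  move=> /time[s0 sT sh hs _]; rewrite subrr.
  have hk : 0 <= (0 : K) < k by rewrite lexx.
  have [r hr E] := flow_dr S hk (ltW kR) sT.
  have RR : 0 <= (0 : K) <= R by rewrite lexx ltW.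
  have I := incr _ _ _ RR (ltW s0) (ltW h0) sh.
  have r0 : 0 <= (0 : K) <= r by clear - hr; lra.
  have rR : r <= R by clear - hr kR; lra.
  have rk : r - 0 <= k by clear - hr; lra.
  have /ltr_normlP[+ _] := cG 0 r s r0 rR rk hs.
  rewrite (flow_center S sT) => Gr.
  have Gk : G r s * k < a * h by rewrite -akE ltr_pM2r //; clear - Gr; lra.
  by move: E; rewrite subr0; clear - I Gk; lra.
have [M M0 HM] := continuous2_bounded (profile_continuous (flow_profile S T2T)).
set c0 := lambda * (p * expR (p * M)).
have c00 : 0 < c0 by rewrite !mulr_gt0 // expR_gt0.
have TT2 : T1 < T by clear - T12 T2T h0; lra.
have P1 : profile k R t0 T1 (fun r t => U (r - k) (t + h)) (fun r t => V (r - k) (t + h))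
    (fun r t => G (r - k) (t + h)) (fun r t => H (r - k) (t + h)).
  have := profile_translate (- k) h (flow_profile S T2T).
  rewrite !opprK add0r => P.
  apply: (@profile_shrink _ _ (R + k)); first by clear - k0 kR; lra.
  apply: profileW P => //; clear - t00 h0 T12; lra.
have P2 : profile k R t0 T1 U V G H.
  by apply: profileW (flow_profile S TT2) => //; rewrite ltW.
(* A perturbation constant in [r] suffices, because the flux inequality [gain] is already strict.
   The exponent [c0 + 1] beats the linearized reaction. *)
suff X e : 0 < e -> 0 < U (R - k) (t + h) - U R t + e * expR ((c0 + 1) * t).
  rewrite -subr_ge0 leNgt; apply/negP => neg.
  have g0 := expR_gt0 ((c0 + 1) * t).
  have := X (- (U (R - k) (t + h) - U R t) / expR ((c0 + 1) * t)).
  rewrite divr_gt0 // ?oppr_gt0 // divfK ?gt_eqF // => /(_ isT).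
  by rewrite addrC addNr ltxx.
move=> ee0.
have d1 (s : K) : is_derive s 1 (fun _ : K => 1 : K) 0 by exact: is_derive1_cst.
have d0 (s : K) : is_derive s 1 (fun _ : K => 0 : K) 0 by exact: is_derive1_cst.
have P3 := profile_separated k R t0 T1
  (fun t => is_derive1_scale e (is_derive1_exp_scale (c0 + 1) t)) d1 d0.
have P := profile_add (profile_sub P1 P2) P3.
have et s : 0 < e * expR ((c0 + 1) * s) by rewrite mulr_gt0 // expR_gt0.
have hR : k <= R <= R by rewrite lexx ltW.
rewrite -[e * _]mulr1.
apply: (profile_positive kR P _ _ _ _ hR ht) => /= {t ht hR P P1 P2 P3 d1 d0}.
- by move=> r hr; rewrite mulr1 addr_gt0 // init.
- move=> t /andP[/ltW tt tT] /eqP; rewrite mulr1 gt_eqF // addr_gt0 //.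
  by apply: left; rewrite tt.
- move=> t /andP[/ltW tt tT] _; rewrite mulr0 addr0 subr_gt0.
  by apply: gain; rewrite tt.
- move=> r t /andP[kr rR] /andP[/ltW tt tT].
  have ht : t0 <= t <= T1 by rewrite tt.
  have {tt tT}[t0' tT th htT _] := time t ht.
  rewrite !mulr0 !addr0 !mulr1 => E /subr0_eq Er; rewrite subr_ge0 => Err.
  have ps0 := et t; set ps := e * expR ((c0 + 1) * t) in E ps0 *.
  (* A zero at [r = k] is excluded by [left], so the shifted point [r - k] is off the centre and
     both radial Laplacians have the regular form. *)
  have rk : k < r.
    rewrite lt_neqAle kr andbT; apply/eqP => kr'.
    have := left t ht; rewrite {1 3}kr' => left_t.
    by move/eqP: E; rewrite gt_eqF // addr_gt0.
  have E1 : U (r - k) (t + h) - U r t = - ps by clear - E; lra.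
  have Uk : U (r - k) (t + h) <= U r t by rewrite -subr_le0 E1 oppr_le0 ltW.
  have kkr : 0 < k <= r by rewrite k0.
  have Gpos : 0 < G r t.
    apply: (flow_dr_gt0 S incr t0' h0 th kkr (ltW rR) akE Uk) => s hs.
    apply: cG => //; clear - hs rk rR k0; lra.
  have hr : 0 <= r < R by rewrite rR (le_trans (ltW k0)).
  have hrk : 0 <= r - k < R by clear - rk hr k0; lra.
  have hth : 0 < t + h < T by rewrite addr_gt0.
  have kkr' : 0 < k < r by rewrite k0.
  have lap := rad_lap_shift nu1 kkr' (ltW Gpos) Err.
  have -> : e * ((c0 + 1) * expR ((c0 + 1) * t)) = (c0 + 1) * ps by rewrite /ps; ring.
  rewrite (flow_pde S hr tT) (flow_pde S hrk hth) Er.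
  have UM : U r t <= M.
    by apply: le_trans (ler_norm _) _; apply: HM; clear - hr t0' htT; lra.
  have := ler_wpM2l (ltW la0) (expR_reaction_ge (ltW p0) UM Uk).
  have -> : U r t - U (r - k) (t + h) = ps by rewrite -[LHS]opprB E1 opprK.
  have -> : lambda * - (p * expR (p * M) * ps) = - (c0 * ps) by rewrite /c0; ring.
  rewrite mulrBr; clear - lap ps0; lra.
Qed.

(** The moduli are taken on [[t0, T2]] with [T1 < T2 < T], which leaves room for [t + h]. They fix
    [h0], which may depend on [T1]; the rate on the left of the inequality depends only on [q] and
    [eps]. *)
Lemma flow_step (K : realType) (R p q lambda nu T a eps t0 T1 : K)
    (U V G H : K -> K -> K) :
  0 < R -> 0 < p -> 0 < q -> 0 < lambda -> 1 <= nu -> 0 < a ->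
  radial_flow R p q lambda nu T U V G H ->
  (forall r t h, 0 <= r <= R -> 0 <= t -> 0 <= h -> t + h < T ->
    U r t + a * h <= U r (t + h)) ->
  (forall r t, 0 <= r <= R -> 0 <= t < T -> 0 <= U r t) ->
  0 < t0 -> t0 <= T1 -> T1 < T -> 0 < eps -> eps <= q / 2 ->
  (forall r, 0 <= r <= R -> eps * G r t0 < a) ->
  exists2 h0, 0 < h0 & forall h t, 0 < h < h0 -> t0 <= t <= T1 ->
    q * eps / 2 * h <= expR (- (q * U R t)) - expR (- (q * U R (t + h))).
Proof.
move=> R0 p0 q0 la0 nu1 a0 S incr Uge0 t00 t01 T1T e0 eq Gt0.
set T2 := (T1 + T) / 2.
have T2T : T2 < T by rewrite /T2; lra.
have T12 : T1 < T2 by rewrite /T2; lra.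
have a4 : 0 < a / 4 by lra.
(* [a / eps] is the tolerance on [G] required by [flow_two_point]. With [1 / 2], [G] stays above
   half of its boundary value [expR (q * U)], which is at least 1. *)
have ae : 0 < Num.min (a / eps) (1 / 2).
  by rewrite lt_min divr_gt0 //=; lra.
have [kV kV0 HV] := continuous2_uniform (flow_continuous_dt S t00 T2T) a4.
have [kH kH0 HH] := continuous2_uniform (flow_continuous_drr S t00 T2T) a4.
have [kG kG0 HG] := continuous2_uniform (flow_continuous_dr S t00 T2T) ae.
set m := Num.min (Num.min kV kH) (Num.min kG R).
have m0 : 0 < m by rewrite !lt_min kV0 kH0 kG0 R0.
have [mV mH mG mR] : [/\ m <= kV, m <= kH, m <= kG & m <= R].
  by rewrite !ge_min !lexx !orbT.
move: m m0 mV mH mG mR => m m0 mV mH mG mR.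
exists (Num.min (T2 - T1) (Num.min m (m / eps))).
  by rewrite !lt_min m0 divr_gt0 //= subr_gt0 T12.
move=> h t /andP[h0]; rewrite !lt_min => /and3P[hT hm hme] ht.
have km : eps * h < m by rewrite mulrC -ltr_pdivlMr.
have k0 : 0 < eps * h by rewrite mulr_gt0.
have [Ga Gh] : (forall x, x < Num.min (a / eps) (1 / 2) -> x < a / eps) /\
   (forall x, x < Num.min (a / eps) (1 / 2) -> x < 1 / 2).
  by split=> x; rewrite lt_min => /andP[].
have two : U R t <= U (R - eps * h) (t + h).
  have kR : eps * h < R by exact: lt_le_trans km mR.
  have T12h : T1 + h <= T2 by rewrite addrC -lerBrDr ltW.
  apply: (flow_two_point R0 p0 q0 la0 nu1 a0 S incr Uge0 t00 t01 T12h T2T h0 e0 erefl kR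
    eq Gt0 _ _ _ ht).
  - move=> r s s' hr rk hs hs' ss'; apply: HV => //.
    + by clear - ss' hs hs'; lra.
    + by rewrite lexx ltW.
    + by clear - hs hs' h0; lra.
    + by clear - hr km rk mV; rewrite ltr_norml; lra.
    + by clear - ss' hm mV h0; rewrite ltr_norml; lra.
  - move=> r s hr hs; apply: HH => //; rewrite ?subrr ?normr0 //.
    + by clear - hr kR; lra.
    + by rewrite lexx ltW.
    + by clear - hr km mH k0; rewrite ltr_norml; lra.
  - move=> r s s' hr sR rs hs; apply: Ga; apply: HG => //; rewrite ?subrr ?normr0 //.
    + by clear - hr sR; lra.
    + by clear - hr sR; lra.
    + by clear - hr rs km mG k0; rewrite ltr_norml; lra.
have th : 0 < t + h < T by clear - ht t00 h0 hT T12 T2T; lra.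
have hk : 0 <= R - eps * h < R by clear - k0 km mR; lra.
have RR : 0 <= R <= R by rewrite lexx ltW.
have [s hs E] := flow_dr S hk (lexx R) th.
have Uth : 0 <= U R (t + h) by apply: Uge0 => //; case/andP: th => /ltW -> ->.
have expU : 1 <= expR (q * U R (t + h)) by rewrite -expR0 ler_expR mulr_ge0 // ltW.
have Gs : expR (q * U R (t + h)) / 2 <= G s (t + h).
  have : `|G R (t + h) - G s (t + h)| < 1 / 2.
    apply: Gh; apply: HG; rewrite ?subrr ?normr0 //.
    + by clear - ht hT h0; lra.
    + by clear - hs hk; lra.
    + by clear - ht hT h0; lra.
    + by clear - hs km mG k0; rewrite ltr_norml; lra.
  rewrite (flow_flux S) // ltr_norml => /andP[_ X].
  by clear - X expU; lra.
have gain : expR (q * U R (t + h)) / 2 * (eps * h) <= U R (t + h) - U R t.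
  have : expR (q * U R (t + h)) / 2 * (eps * h) <= G s (t + h) * (eps * h).
    by rewrite ler_pM2r.
  by rewrite subKr in E; clear - two E; lra.
(* Convexity at the later time: the factor [expR (- (q * U R (t + h)))] cancels the exponential in
   [gain], which leaves a rate independent of [U]. *)
apply: le_trans (expR_sub_ge _ _).
have -> : - (q * U R t) - - (q * U R (t + h)) = q * (U R (t + h) - U R t) by ring.
have -> : q * eps / 2 * h = expR (- (q * U R (t + h))) *
    (q * (expR (q * U R (t + h)) / 2 * (eps * h))).
  have : expR (- (q * U R (t + h))) * expR (q * U R (t + h)) = 1.
    by rewrite -expRD addNr expR0.
  move=> EE; transitivity ((expR (- (q * U R (t + h))) * expR (q * U R (t + h)))
    * (q * eps / 2 * h)); first by rewrite EE mul1r.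
  by field.
by rewrite ler_pM2l ?expR_gt0 // ler_pM2l.
Qed.

(** [[t, T1]] is cut into [N] equal steps shorter than [h0]; the decreases telescope and the final
    value of [Y] is nonnegative. *)
Lemma decrease_by_steps (K : realType) (Y : K -> K) (c t0 T1 h0 : K) :
  0 < h0 -> (forall t, 0 <= Y t) ->
  (forall h t, 0 < h < h0 -> t0 <= t <= T1 -> c * h <= Y t - Y (t + h)) ->
  forall t, t0 <= t <= T1 -> c * (T1 - t) <= Y t.
Proof.
move=> h00 Y0 step t ht.
have [->|tT] := eqVneq t T1; first by rewrite subrr mulr0.
have tT1 : t < T1 by rewrite lt_neqAle tT; lra.
set N := Num.bound ((T1 - t) / h0).
have HN : (T1 - t) / h0 < N%:R.
  by apply: archi_boundP; apply: divr_ge0; lra.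
have N0 : 0 < N%:R :> K.
  by apply: le_lt_trans HN; apply: divr_ge0; lra.
set h := (T1 - t) / N%:R.
have h0' : 0 < h by apply: divr_gt0 => //; lra.
have hh0 : h < h0 by rewrite /h ltr_pdivrMr // mulrC -ltr_pdivrMr.
have Nh : N%:R * h = T1 - t by rewrite /h mulrC divfK // gt_eqF.
have iter i : (i <= N)%N -> c * (i%:R * h) <= Y t - Y (t + i%:R * h).
  elim: i => [|i IH] iN; first by rewrite mul0r mulr0 addr0 subrr.
  have := IH (ltnW iN).
  have iNh : i%:R * h <= N%:R * h by rewrite ler_pM2r // ler_nat ltnW.
  have ih0 : 0 <= i%:R * h by rewrite mulr_ge0 // ltW.
  have := step h (t + i%:R * h); rewrite h0' hh0 => /(_ isT) st.
  have : c * h <= Y (t + i%:R * h) - Y (t + i%:R * h + h) by apply: st; lra.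
  have -> : t + i%:R * h + h = t + i.+1%:R * h by rewrite -[in RHS]natr1; ring.
  have -> : c * (i.+1%:R * h) = c * (i%:R * h) + c * h by rewrite -natr1; ring.
  lra.
have := iter N (leqnn N); rewrite Nh; have := Y0 (t + (T1 - t)); lra.
Qed.

(** On [[T / 2, T)] the step estimate is summed up to every [T1 < T] with one constant, and [T1]
    then tends to [T]. Earlier times follow from monotonicity of [U] in time. *)
Lemma radial_flow_rate (K : realType) (R p q lambda nu T a : K)
    (U V G H : K -> K -> K) (f f' f'' : K -> K) :
  0 < R -> 0 < p -> 0 < q -> 0 < lambda -> 1 <= nu -> 0 < a -> 0 < T ->
  radial_flow R p q lambda nu T U V G H ->
  {within `[0, R], continuous f} ->
  (forall r, 0 <= r < R -> is_derive r 1 f (f' r)) ->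
  (forall r, 0 <= r < R -> is_derive r 1 f' (f'' r)) ->
  f' r @[r --> R^'-] --> f' R -> f' 0 = 0 -> f' R = expR (q * f R) ->
  (forall r, 0 <= r < R -> a <= rad_lap nu r (f' r) (f'' r) + lambda * expR (p * f r)) ->
  (forall r, 0 <= r <= R -> 0 <= f r) ->
  (forall r, 0 <= r <= R -> U r 0 = f r) ->
  exists2 c, 0 < c & forall t, 0 < t < T -> c * (T - t) <= expR (- (q * U R t)).
Proof.
move=> R0 p0 q0 la0 nu1 a0 T0 S cf df df' fl f'0 f'R sub f0 init.
have above := flow_above_initial R0 p0 q0 la0 nu1 a0 S cf df df' fl f'0 f'R sub init.
have incr := flow_increment_ge R0 p0 q0 la0 nu1 a0 S above.
have Uge0 r t : 0 <= r <= R -> 0 <= t < T -> 0 <= U r t.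
  move=> hr ht; apply: le_trans (above r t hr ht).
  by rewrite init // addr_ge0 ?f0 // mulr_ge0 //; lra.
set t0 := T / 2.
have t00 : 0 < t0 by rewrite /t0; lra.
have t0T : t0 < T by rewrite /t0; lra.
have [M M0 HM] := continuous2_bounded (flow_continuous_dr S t00 t0T).
(* [M] bounds the radial derivative at the starting time [t0], so the second term gives
   [eps * G r t0 <= a / 2 < a]. *)
set eps := Num.min (q / 2) (a / (2 * M)).
have e0 : 0 < eps by rewrite lt_min !divr_gt0 // mulr_gt0.
have [e1 e2] : eps <= q / 2 /\ eps <= a / (2 * M) by rewrite !ge_min !lexx orbT.
have eG r : 0 <= r <= R -> eps * G r t0 < a.
  move=> hr; have tt : t0 <= t0 <= t0 by rewrite lexx.
  have : eps * G r t0 <= a / (2 * M) * M.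
    apply: le_trans (_ : eps * M <= _); last by rewrite ler_pM2r.
    by rewrite ler_pM2l //; apply: le_trans (ler_norm _) (HM r t0 hr tt).
  have -> : a / (2 * M) * M = a / 2 by field; rewrite gt_eqF.
  lra.
set c := q * eps / 2.
have c0 : 0 < c by rewrite divr_gt0 // mulr_gt0.
have late T1 t : T1 < T -> t0 <= t <= T1 -> c * (T1 - t) <= expR (- (q * U R t)).
  move=> T1T ht; have t01 : t0 <= T1 by lra.
  have [h0 h00 step] := flow_step R0 p0 q0 la0 nu1 a0 S incr Uge0 t00 t01 T1T e0 e1 eG.
  apply: (decrease_by_steps (Y := fun t => expR (- (q * U R t))) h00 _ step ht).
  by move=> s; exact: expR_ge0.
(* Limit [T1 -> T] by contradiction: a deficit [c * d] at [t] would exceed the error [c * m] made by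
   stopping at [T - m]. *)
have main t : t0 <= t < T -> c * (T - t) <= expR (- (q * U R t)).
  move=> ht; rewrite leNgt; apply/negP => X.
  set d := (c * (T - t) - expR (- (q * U R t))) / c.
  have d0 : 0 < d by apply: divr_gt0 => //; lra.
  have cd : c * d = c * (T - t) - expR (- (q * U R t)).
    by rewrite /d mulrC divfK // gt_eqF.
  set m := Num.min (d / 2) (T - t).
  have m0 : 0 < m by rewrite lt_min; apply/andP; split; lra.
  have [m1 m2] : m <= d / 2 /\ m <= T - t by rewrite !ge_min !lexx orbT.
  have := late (T - m) t; have -> : T - m < T by lra.
  have -> : t0 <= t <= T - m by lra.
  move=> /(_ isT isT).
  have : c * m < c * d by rewrite ltr_pM2l //; lra.
  lra.
(* For [t < T / 2] the value at [T / 2] only gives [c * T / 2], which still dominates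
   [c / 2 * (T - t)]. *)
exists (c / 2) => [|t ht]; first by lra.
have ct : 0 <= c * (T - t) by rewrite mulr_ge0 //; lra.
have [tt0|tt0] := leP t0 t.
  have tt0T : t0 <= t < T by lra.
  apply: le_trans (main t tt0T).
  have -> : c / 2 * (T - t) = c * (T - t) / 2 by ring.
  lra.
have RR : 0 <= R <= R by rewrite lexx ltW.
have := incr R t (t0 - t) RR; rewrite addrCA subrr addr0 => /(_ _ _ t0T) inc.
have mono : U R t <= U R t0.
  have : U R t + a * (t0 - t) <= U R t0 by apply: inc; lra.
  have : 0 <= a * (t0 - t) by rewrite mulr_ge0 //; lra.
  lra.
have : expR (- (q * U R t0)) <= expR (- (q * U R t)).
  by rewrite ler_expR lerN2 ler_pM2l.
have := main t0; have -> : t0 <= t0 < T by lra.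
move=> /(_ isT).
have : 0 <= c * t by rewrite mulr_ge0 //; lra.
have -> : c * (T - t0) = c * T / 2 by rewrite /t0; field.
have -> : c / 2 * (T - t) = c * T / 2 - c * t / 2 by ring.
lra.
Qed.

(** * Reduction to the radial variable *)

Section Trace.
Context (K : realType) (V : topologicalType) (D : set V) (f : V -> K).

(** For [x] in [D], the filter [within D (nbhs x)] does not remove [x] itself, so mere convergence
    forces the limit to be [f x]. *)
Lemma trace_in x : D x -> cvg (f y @[y --> within D (nbhs x)]) -> trace D f x = f x.
Proof.
move=> Dx cf; apply/eqP; rewrite -subr_eq0 -normr_eq0; apply/negP => /negP n0.
have e0 : 0 < `|trace D f x - f x| by rewrite lt_neqAle eq_sym n0 normr_ge0.
have /cvgrPdist_lt /(_ _ e0) := cf.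
by rewrite near_withinE => /nbhs_singleton /(_ Dx); rewrite ltxx.
Qed.

(** The limits at nearby points [x] and [x'] are compared through one point [y] of [D] close to
    both; it exists because [x'] lies in the closure of [D]. *)
Lemma trace_continuous (A : set V) :
  (forall x, A x -> cvg (f y @[y --> within D (nbhs x)])) ->
  A `<=` closure D -> {within A, continuous (trace D f)}.
Proof.
move=> cf AD; apply/subspace_continuousP => x Ax; apply/cvgrPdist_lt => e e0.
have e20 : 0 < e / 2 by lra.
have /cvgrPdist_lt /(_ _ e20) := cf x Ax.
rewrite !near_withinE => /nbhs_interior; apply: filterS => x' Hx' Ax'.
have PF : ProperFilter (within D (nbhs x')) by apply: within_nbhs_proper; exact: AD.
have /cvgrPdist_lt /(_ _ e20) := cf x' Ax'.
rewrite near_withinE => H2.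
have : \forall y \near within D (nbhs x'),
    `|trace D f x - f y| < e / 2 /\ `|trace D f x' - f y| < e / 2.
  rewrite near_withinE; apply: filterS2 Hx' H2 => y H1 H2 Dy.
  by split; [exact: H1|exact: H2].
move=> /filter_ex[y [+]]; rewrite !ltr_norml => ? ?.
rewrite /from_subspace.
lra.
Qed.

End Trace.

Lemma within_continuous_pullback (X Y Z : topologicalType) (A : set X) (B : set Y)
    (g : X -> Y) (f : Y -> Z) :
  continuous g -> (forall x, A x -> B (g x)) -> {within B, continuous f} ->
  {within A, continuous (fun x => f (g x))}.
Proof.
move=> cg AB /subspace_continuousP cf; apply/subspace_continuousP => x Ax.
apply: cvg_comp (cf _ (AB x Ax)) => W; rewrite /within /= !nbhs_simpl /= => HW.
have H : \forall y \near x, B (g y) -> W (g y) by exact: (cg x _ HW).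
rewrite near_simpl; near=> y => Ay /=; have := AB _ Ay; near: y; exact: H.
Unshelve. all: by end_near. Qed.

Lemma within_continuous_left (K : realType) (R : K) (f : K -> K) : 0 < R ->
  {within `[0, R], continuous f} -> f r @[r --> R^'-] --> f R.
Proof. by move=> R0 /continuous_within_itvP[]. Qed.

Lemma is_derive_line (K : realType) (n : nat) (g : 'rV[K]_n -> K) (x v : 'rV[K]_n) (s : K) :
  derivable g (x + s *: v) v -> is_derive s 1 (fun s => g (x + s *: v)) ('D_v g (x + s *: v)).
Proof.
have E : (fun h : K => h^-1 *: (((fun s : K => g (x + s *: v)) \o shift s) (h *: 1) -
    g (x + s *: v))) =
  (fun h => h^-1 *: ((g \o shift (x + s *: v)) (h *: v) - g (x + s *: v))).
  apply/funext => h /=; congr (_ *: (g _ - _)).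
  by rewrite [h *: 1]mulr1 scalerDl addrCA.
move=> dg; split; first by rewrite /derivable E.
by rewrite /derive E.
Qed.

Lemma is_derive_uniq (K : realType) (f : K -> K) (x a b : K) :
  is_derive x 1 f a -> is_derive x 1 f b -> a = b.
Proof. by move=> [_ <-] [_ <-]. Qed.

Lemma is_derive_near (K : realType) (f g : K -> K) (x a d : K) : 0 < d ->
  (forall y, `|y - x| < d -> f y = g y) -> is_derive x 1 f a -> is_derive x 1 g a.
Proof.
move=> d0 fg; apply: near_eq_is_derive.
by apply/nbhs_ballP; exists d => // y /= xy; apply: fg; rewrite distrC.
Qed.

Lemma is_derive1_hypot (K : realType) (r s : K) : 0 < r ->
  is_derive s 1 (fun s : K => Num.sqrt (r ^+ 2 + s ^+ 2))
    (s / Num.sqrt (r ^+ 2 + s ^+ 2)).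
Proof.
move=> r0.
have rs0 : 0 < r ^+ 2 + s ^+ 2 by rewrite ltr_pwDl ?exprn_gt0 ?sqr_ge0.
have d1 : is_derive s 1 (fun s : K => r ^+ 2 + s ^+ 2) (0 + (s * 1 + s * 1)).
  exact: is_derive1_add (is_derive1_cst s (r ^+ 2))
    (is_derive1_mul (is_derive1_id s) (is_derive1_id s)).
have := @is_derive1_comp K Num.sqrt (fun s : K => r ^+ 2 + s ^+ 2) s _ _
  (is_derive1_sqrt rs0) d1.
move=> /is_derive_eq; apply.
by field; rewrite gt_eqF // sqrtr_gt0.
Qed.

(** * Radial functions restricted to a coordinate ray *)

Section Ray.
Context (K : realType) (n : nat) (i0 : 'I_n).

Definition ray (r : K) : 'rV[K]_n := r *: delta_mx 0 i0.

Lemma ray_coord r i : ray r 0 i = if i == i0 then r else 0.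
Proof.
by rewrite /ray !mxE eqxx /=; case: eqP => _; rewrite ?mulr1 ?mulr0.
Qed.

Lemma enorm_ray r : enorm (ray r) = `|r|.
Proof.
rewrite /enorm (bigD1 i0) //= big1 => [|i ii0]; last by rewrite ray_coord (negbTE ii0) expr0n.
by rewrite ray_coord eqxx addr0 sqrtr_sqr.
Qed.

Lemma enorm_ray_side r s (j : 'I_n) : j != i0 ->
  enorm (ray r + s *: delta_mx 0 j) = Num.sqrt (r ^+ 2 + s ^+ 2).
Proof.
move=> ji; rewrite /enorm (bigD1 i0) //= (bigD1 j) //= big1 => [|i /andP[ii0 ij]].
  rewrite !mxE !eqxx /= [i0 == j]eq_sym (negbTE ji) /=.
  by rewrite !mulr1 !mulr0 addr0 add0r addr0.
by rewrite !mxE !eqxx /= (negbTE ii0) (negbTE ij) !mulr0 addr0 expr0n.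
Qed.

Lemma enorm_delta s (j : 'I_n) : enorm (s *: delta_mx 0 j : 'rV[K]_n) = `|s|.
Proof.
rewrite /enorm (bigD1 j) //= big1 => [|i ij].
  by rewrite !mxE !eqxx /= mulr1 addr0 sqrtr_sqr.
by rewrite !mxE !eqxx /= (negbTE ij) mulr0 expr0n.
Qed.

Lemma ray_continuous : continuous ray.
Proof. exact: scalel_continuous. Qed.

Lemma is_derive_ray (g : 'rV[K]_n -> K) r : derivable g (ray r) (delta_mx 0 i0) ->
  is_derive r 1 (fun s => g (ray s)) (partial i0 g (ray r)).
Proof.
move=> dg; have := @is_derive_line K n g 0 (delta_mx 0 i0) r; rewrite add0r => /(_ dg).
by under eq_fun do rewrite add0r.
Qed.

Context (R : K) (g : 'rV[K]_n -> K).
Context (R0 : 0 < R).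
Context (g_radial : radial_on_cball R g).
Context (g_d : forall x (i : 'I_n), oball n R x -> derivable g x (delta_mx 0 i)).
Context (g_dd : forall x (i j : 'I_n), oball n R x ->
  derivable (partial i g) x (delta_mx 0 j)).

Lemma oball_ray r : `|r| < R -> oball n R (ray r).
Proof. by rewrite /oball /= enorm_ray. Qed.

(** A radial function is even along the axis: the chain rule for the reflection [s -> - s] gives the
    derivative at 0 two opposite values. *)
Lemma partial_center : partial i0 g 0 = 0.
Proof.
have r0 : ray 0 = 0 by rewrite /ray scale0r.
have H0 : oball n R (ray 0) by apply: oball_ray; rewrite normr0.
have d1 := is_derive_ray (g_d H0).
have d2 := is_derive1_scale (-1 : K) (is_derive1_id (0 : K)).
have d1' : is_derive (-1 * 0 : K) 1 (fun s => g (ray s)) (partial i0 g (ray 0)).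
  by rewrite mulr0.
have d3 := @is_derive1_comp K (fun s => g (ray s)) ( *%R (-1)) 0 _ _ d1' d2.
have d4 : is_derive (0 : K) 1 (fun s => g (ray s)) (partial i0 g (ray 0) * (-1 * 1)).
  apply: is_derive_near R0 _ d3 => s; rewrite subr0 => sR /=.
  by apply: g_radial; rewrite /cball /= ?enorm_ray ?mulN1r ?normrN // ltW.
have := is_derive_uniq d1 d4; rewrite -r0; lra.
Qed.

(** Perpendicular to the ray, [g] is its radial profile at [rho s = sqrt (r^2 + s^2)]. Its
    derivative is the radial one at [rho s] multiplied by [s / rho s]; as this factor vanishes at
    [s = 0], a second differentiation there leaves only the radial derivative divided by [r]. Only
    one-variable chain rules are involved. *)
Lemma partial2_side r (j : 'I_n) : 0 < r < R -> j != i0 ->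
  partial j (partial j g) (ray r) = partial i0 g (ray r) / r.
Proof.
move=> hr ji; have r0 : 0 < r by lra.
pose rho s := Num.sqrt (r ^+ 2 + s ^+ 2).
have rho0 s : 0 < rho s by rewrite sqrtr_gt0 ltr_pwDl ?exprn_gt0 ?sqr_ge0.
have rho_0 : rho 0 = r by rewrite /rho expr0n addr0 sqrtr_sqr gtr0_norm.
have rhoR s : `|s| < R - r -> rho s < R.
  move=> hs; rewrite -[ltRHS]ger0_norm ?(ltW R0) // -sqrtr_sqr ltr_sqrt ?exprn_gt0 //.
  have : `|s| ^+ 2 < (R - r) ^+ 2 by rewrite ltr_pXn2r ?nnegrE //; lra.
  rewrite -normrX ger0_norm ?sqr_ge0 // => X.
  have : 0 < r * (R - r) by rewrite mulr_gt0 //; lra.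
  rewrite !expr2 in X *; lra.
pose side s := ray r + s *: delta_mx 0 j : 'rV[K]_n.
have sideR s : `|s| < R - r -> oball n R (side s).
  by move=> hs; rewrite /oball /= enorm_ray_side //; exact: rhoR.
have rayR s : `|s| < R - r -> oball n R (ray (rho s)).
  by move=> hs; apply: oball_ray; rewrite gtr0_norm //; exact: rhoR.
have rR0 : 0 < R - r by lra.
have gside s : `|s| < R - r -> g (side s) = g (ray (rho s)).
  move=> hs; apply: g_radial.
  - by apply: ltW; exact: sideR.
  - by apply: ltW; exact: rayR.
  - by rewrite enorm_ray_side // enorm_ray gtr0_norm.
have pside s : `|s| < R - r ->
    partial j g (side s) = partial i0 g (ray (rho s)) * (s / rho s).
  move=> hs.
  have d1 : is_derive s 1 (fun s => g (side s)) (partial j g (side s)).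
    by apply: is_derive_line; apply: g_d; exact: sideR.
  have d2 := @is_derive1_comp K (fun s => g (ray s)) rho s _ _
    (is_derive_ray (g_d (rayR s hs))) (is_derive1_hypot s r0).
  have hs0 : 0 < R - r - `|s| by lra.
  apply: is_derive_uniq d1 _; apply: is_derive_near hs0 _ d2 => s' hs' /=.
  rewrite gside //.
  have := ler_normD (s' - s) s; rewrite subrK; lra.
have side0 : side 0 = ray r by rewrite /side scale0r addr0.
have h0 : `|0 : K| < R - r by rewrite normr0.
have d1 : is_derive (0 : K) 1 (fun s => partial j g (side s)) (partial j (partial j g) (side 0)).
  by apply: is_derive_line; apply: g_dd; exact: sideR.
have d2 := @is_derive1_comp K (fun s => partial i0 g (ray s)) rho 0 _ _
  (is_derive_ray (g_dd (rayR 0 h0))) (is_derive1_hypot 0 r0).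
have rho0n : rho 0 != 0 by rewrite gt_eqF.
have d3 := is_deriveV rho0n (is_derive1_hypot 0 r0).
have d4 := is_derive1_mul d2 (is_derive1_mul (is_derive1_id 0) d3).
rewrite -side0; apply: is_derive_uniq d1 _.
apply: (is_derive_near rR0 (f := fun s => partial i0 g (ray (rho s)) * (s * (rho s)^-1))).
  by move=> s; rewrite subr0 => hs; rewrite pside.
apply: is_derive_eq d4 _ => /=.
by rewrite !mul0r rho_0 side0 add0r mulr1 addr0.
Qed.

(** The restrictions of a radial function to any two axes through the centre coincide, hence so do
    their derivatives. *)
Lemma partial2_center (j : 'I_n) :
  partial j (partial j g) 0 = partial i0 (partial i0 g) 0.
Proof.
have side (i : 'I_n) s : `|s| < R -> oball n R (s *: delta_mx 0 i : 'rV[K]_n).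
  by rewrite /oball /= enorm_delta.
have p1 (i : 'I_n) (s : K) : `|s| < R -> is_derive s 1 (fun s => g (s *: delta_mx 0 i))
    (partial i g (s *: delta_mx 0 i)).
  move=> hs; have := @is_derive_line K n g 0 (delta_mx 0 i) s; rewrite add0r.
  under [X in is_derive _ _ X]eq_fun do rewrite add0r.
  by apply; apply: g_d; exact: side.
have p2 (i : 'I_n) : is_derive (0 : K) 1 (fun s => partial i g (s *: delta_mx 0 i))
    (partial i (partial i g) 0).
  have := @is_derive_line K n (partial i g) 0 (delta_mx 0 i) 0; rewrite add0r.
  under [X in is_derive _ _ X]eq_fun do rewrite add0r.
  rewrite scale0r; apply; apply: g_dd; rewrite -(scale0r (delta_mx 0 i)).
  by apply: side; rewrite normr0.
have E s : `|s| < R -> partial i0 g (s *: delta_mx 0 i0) = partial j g (s *: delta_mx 0 j).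
  move=> hs; have hs0 : 0 < R - `|s| by lra.
  apply: is_derive_uniq (p1 i0 s hs) _; apply: is_derive_near hs0 _ (p1 j s hs) => s' hs'.
  have hs'R : `|s'| <= R by have := ler_normD (s' - s) s; rewrite subrK; lra.
  by apply: g_radial; rewrite /cball /= !enorm_delta.
apply/esym; apply: is_derive_uniq (p2 i0) _; apply: is_derive_near R0 _ (p2 j) => s.
by rewrite subr0 => hs; rewrite E.
Qed.

Lemma laplacian_ray r : 0 <= r < R -> laplacian g (ray r) =
  rad_lap n%:R r (partial i0 g (ray r)) (partial i0 (partial i0 g) (ray r)).
Proof.
move=> hr; rewrite /laplacian /rad_lap; case: ifPn => [/eqP ->|r0].
  rewrite /ray scale0r; under eq_bigr do rewrite partial2_center.
  by rewrite sumr_const card_ord mulr_natl.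
have hr' : 0 < r < R by rewrite lt_neqAle eq_sym r0; lra.
rewrite (bigD1 i0) //=; congr (_ + _).
under eq_bigr => j ji do rewrite partial2_side //.
rewrite sumr_const cardC1 card_ord -[LHS]mulr_natl; congr (_ * _).
by have n0 := ltn_ord i0; rewrite -{2}(prednK (leq_ltn_trans (leq0n _) n0)) -natr1 addrK.
Qed.

Lemma normal_derivative_ray :
  normal_derivative R g (ray R) = trace (oball n R) (partial i0 g) (ray R).
Proof.
rewrite /normal_derivative (bigD1 i0) //= big1 => [|i ii0].
  by rewrite ray_coord eqxx divff ?gt_eqF // mul1r addr0.
by rewrite ray_coord (negbTE ii0) !mul0r.
Qed.

End Ray.

Lemma closure_ray (K : realType) (n : nat) (i0 : 'I_n) (R r : K) : 0 < R -> 0 <= r <= R ->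
  closure (oball n R) (ray i0 r).
Proof.
move=> R0 hr B HB.
have /nbhs_ballP[d /= d0 Hd] := @ray_continuous K n i0 r B HB.
set m := Num.min (d / 2) (R / 2).
have m0 : 0 < m by rewrite lt_min; apply/andP; split; lra.
have [m1 m2] : m <= d / 2 /\ m <= R / 2 by rewrite !ge_min !lexx orbT.
exists (ray i0 (r - m)); split.
  by apply: oball_ray; rewrite ltr_norml; lra.
apply: Hd; rewrite /ball /= opprB addrC subrK gtr0_norm //; lra.
Qed.

Lemma closure_cylinder_ray (K : realType) (n : nat) (i0 : 'I_n) (R T r t : K) : 0 < R ->
  0 <= r <= R -> 0 < t < T ->
  closure (oball n R `*` [set t : K | 0 < t < T]) (ray i0 r, t).
Proof.
move=> R0 hr ht B [[B1 B2] /= [HB1 HB2] HB].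
have [x [Dx B1x]] := closure_ray (i0 := i0) R0 hr HB1.
exists (x, t); split => //; apply: HB; split => //=.
exact: nbhs_singleton HB2.
Qed.

Section Solution.
Context (K : realType) (n : nat) (i0 : 'I_n) (R p q lambda T : K).
Context (u0 : 'rV[K]_n -> K) (u : 'rV[K]_n -> K -> K).
Context (R0 : 0 < R).
Context (sol : classical_solution R p q lambda u0 T u).
Context (rad : forall t : K, 0 <= t < T -> radial_on_cball R (u ^~ t)).

Let D := oball n R `*` [set t : K | 0 < t < T].

Let trace_ray (f : 'rV[K]_n * K -> K) (r t : K) := trace D f (ray i0 r, t).

Let ray_pair_continuous : continuous (fun z : K * K => (ray i0 z.1, z.2)).
Proof.
move=> z; apply: (cvg_pair (G := nbhs (ray i0 z.1)) (H := nbhs z.2)); last exact: cvg_snd.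
by apply: (continuous_comp (f := fst)); [exact: cvg_fst|exact: ray_continuous].
Qed.

Let trace_ray_continuous (f : 'rV[K]_n * K -> K) t0 t1 :
  extends_to D (cball n R `*` [set t : K | 0 < t < T]) f -> 0 < t0 -> t1 < T ->
  continuous2 (rect 0 R t0 t1) (trace_ray f).
Proof.
move=> ext t00 t1T.
(* Restricting the trace to points of the ray reduces the density requirement to
   [closure_cylinder_ray]. *)
pose A := [set z : 'rV[K]_n * K | exists2 r, 0 <= r <= R & z.1 = ray i0 r /\ 0 < z.2 < T].
apply: (@within_continuous_pullback _ _ _ _ A _ _ ray_pair_continuous).
  by move=> [r t] /rectP[hr ht]; exists r => //=; split => //; lra.
apply: trace_continuous => -[x t] [r hr] /= [-> ht].
  apply: ext; split => //=; rewrite /cball /= enorm_ray ger0_norm; lra.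
exact: closure_cylinder_ray.
Qed.

Let trace_ray_in (f : 'rV[K]_n * K -> K) r t :
  extends_to D (cball n R `*` [set t : K | 0 < t < T]) f -> `|r| < R -> 0 < t < T ->
  trace_ray f r t = f (ray i0 r, t).
Proof.
move=> ext hr ht; apply: trace_in.
  by split => //=; exact: oball_ray.
by apply: ext; split => //=; rewrite /cball /= enorm_ray ltW.
Qed.

(** Space-time traces are used because they are continuous up to [r = R]; for [r < R] they coincide
    with the actual derivatives, where the equation holds. *)
Lemma solution_radial_flow : radial_flow R p q lambda n%:R T
  (fun r t => u (ray i0 r) t)
  (trace_ray (fun z => dt u z.1 z.2))
  (trace_ray (fun z => partial i0 (u ^~ z.2) z.1))
  (trace_ray (fun z => partial i0 (partial i0 (u ^~ z.2)) z.1)).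
Proof.
have [[der cu ext_t ext_i ext_ij] cu0 pde bnd _] := sol.
have der_t x t : oball n R x -> 0 < t < T -> derivable (u x) t 1.
  by move=> hx ht; have [+ _ _] := der x t hx ht.
have der_x x t (i : 'I_n) : oball n R x -> 0 < t < T ->
    derivable (u ^~ t) x (delta_mx 0 i).
  by move=> hx ht; have [_ + _] := der x t hx ht; exact.
have der_xx x t (i j : 'I_n) : oball n R x -> 0 < t < T ->
    derivable (partial i (u ^~ t)) x (delta_mx 0 j).
  by move=> hx ht; have [_ _ +] := der x t hx ht; exact.
have G_flux t : 0 < t < T ->
    trace_ray (fun z => partial i0 (u ^~ z.2) z.1) r t @[r --> R^'-] -->
    trace_ray (fun z => partial i0 (u ^~ z.2) z.1) R t.
  move=> ht; have /andP[t0 tT] := ht.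
  have := trace_ray_continuous (ext_i i0) t0 tT.
  move=> /continuous2_section/(_ (_ : t <= t <= t)) c.
  by apply: (within_continuous_left R0); apply: c; rewrite lexx.
split.
- move=> t1 t1T; split.
  + apply: (@within_continuous_pullback _ _ _ _
      (cball n R `*` [set t : K | 0 <= t < T]) _ (fun z => u z.1 z.2) ray_pair_continuous) => //.
    move=> [r t] /rectP[hr ht]; split => /=; last by lra.
    rewrite /cball /= enorm_ray ger0_norm; lra.
  + move=> r t hr ht; have ht' : 0 < t < T by lra.
    have hr' : `|r| < R by rewrite ger0_norm; lra.
    rewrite (trace_ray_in ext_t hr' ht') /dt derive1E.
    by apply/derivableP/der_t => //; exact: oball_ray.
  + move=> r t hr ht; have ht' : 0 < t < T by lra.
    have hr' : `|r| < R by rewrite ger0_norm; lra.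
    rewrite (trace_ray_in (ext_i i0) hr' ht') /=.
    by apply: (is_derive_ray (g := u ^~ t)); apply: der_x => //; exact: oball_ray.
  + move=> r t hr ht; have ht' : 0 < t < T by lra.
    have hr' : `|r| < R by rewrite ger0_norm; lra.
    rewrite (trace_ray_in (ext_ij i0 i0) hr' ht') /=.
    have d0 : 0 < R - r by lra.
    apply: is_derive_near d0 _ (is_derive_ray (g := partial i0 (u ^~ t)) _) => [s hs|].
      rewrite (trace_ray_in (ext_i i0) _ ht') //=.
      have := ler_normD (s - r) r; rewrite subrK; have := ger0_norm (x := r); lra.
    by apply: der_xx => //; exact: oball_ray.
  + by move=> t ht; apply: G_flux; lra.
- by move=> t0 t1; exact: (trace_ray_continuous ext_t).
- by move=> t0 t1; exact: (trace_ray_continuous (ext_i i0)).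
- by move=> t0 t1; exact: (trace_ray_continuous (ext_ij i0 i0)).
- move=> t ht; rewrite (trace_ray_in (ext_i i0) _ ht) ?normr0 //= /ray scale0r.
  apply: (partial_center i0 (g := u ^~ t) R0); first by apply: rad; lra.
  by move=> x i hx; exact: der_x.
- move=> r t hr ht; have hr' : `|r| < R by rewrite ger0_norm; lra.
  rewrite (trace_ray_in ext_t hr' ht) (trace_ray_in (ext_i i0) hr' ht)
    (trace_ray_in (ext_ij i0 i0) hr' ht) /=.
  rewrite pde //; last exact: oball_ray.
  rewrite (laplacian_ray i0 (g := u ^~ t) R0) //; first by apply: rad; lra.
  + by move=> x i hx; exact: der_x.
  + by move=> x i j hx; exact: der_xx.
(* The boundary condition takes the trace in the ball at fixed [t], whereas [trace_ray] takes it in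
   space-time; the joint limit restricts to the time slice. *)
- move=> t ht; rewrite -bnd ?enorm_ray ?gtr0_norm // normal_derivative_ray //.
  have RR : 0 <= R <= R by rewrite lexx ltW.
  have PF : ProperFilter (within (oball n R) (nbhs (ray i0 R))).
    by apply: within_nbhs_proper; exact: closure_ray.
  apply/esym; apply: cvg_lim => //.
  have ext : cvg (partial i0 (u ^~ z.2) z.1 @[z --> within D (nbhs (ray i0 R, t))]).
    by apply: ext_i; split => //=; rewrite /cball /= enorm_ray gtr0_norm.
  apply/cvgrPdist_lt => e e0; have /cvgrPdist_lt /(_ _ e0) := ext.
  rewrite !near_withinE => -[[B1 B2] /= [HB1 HB2] HB].
  apply: filterS HB1 => x B1x hx; apply: (HB (x, t)) => //; split => //=.
  exact: nbhs_singleton HB2.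
Qed.

End Solution.

Lemma cvg_laplacian (K : realType) (n : nat) (R : K) (f : 'rV[K]_n -> K) (x : 'rV[K]_n) :
  smooth_cball R f -> cball n R x ->
  cvg (laplacian f y @[y --> within (oball n R) (nbhs x)]).
Proof.
move=> [_ _ ext] hx.
apply/cvg_ex; exists (\sum_(i < n) trace (oball n R) (partials [:: i; i] f) x).
apply: cvg_big => [|i _]; first exact: add_continuous.
exact: ext.
Qed.

Unset Implicit Arguments.

Theorem theorem3p4 (K : realType) (n : nat) (R p q lambda a T : K)
    (u0 : 'rV[K]_n -> K) (u : 'rV[K]_n -> K -> K)
    (hn : (1 <= n)%N) (hR : 0 < R) (hp : 0 < p) (hq : 0 < q)
    (hlambda : 0 < lambda)
    (hu0_smooth : smooth_cball R u0)
    (hu0_ge0 : forall x : 'rV[K]_n, cball n R x -> 0 <= u0 x)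
    (hu0_radial : radial_on_cball R u0)
    (hu0_nondecr : nondecreasing_in_radius R u0)
    (hu0_bnd : forall x : 'rV[K]_n, enorm x = R ->
       normal_derivative R u0 x = expR (q * u0 x))
    (hu0_sub : forall x : 'rV[K]_n, cball n R x ->
       0 <= trace (oball n R) (laplacian u0) x + lambda * expR (p * u0 x))
    (hu0_r : forall x : 'rV[K]_n, cball n R x -> 0 <= radial_derivative R u0 x)
    (ha : 0 < a)
    (hu0_a : forall x : 'rV[K]_n, cball n R x ->
       a <= trace (oball n R) (laplacian u0) x + lambda * expR (p * u0 x))
    (hT : 0 < T)
    (hu : classical_solution R p q lambda u0 T u)
    (hu_radial : forall t : K, 0 <= t < T -> radial_on_cball R (u ^~ t))
    (hu_blowup : blowup_time R p q lambda u0 T u) :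
  exists2 C : K, 0 < C &
    forall t : K, 0 < t < T -> forall x : 'rV[K]_n, enorm x = R ->
      u x t <= ln C - q^-1 * ln (T - t).
Proof.
pose i0 : 'I_n := Ordinal hn.
have S := solution_radial_flow i0 hR hu hu_radial.
have n1 : 1 <= n%:R :> K by rewrite ler1n.
have [c0 der ext] := hu0_smooth.
have ballW r : 0 <= r < R -> oball n R (ray i0 r).
  by move=> hr; apply: oball_ray; rewrite ger0_norm; lra.
have cballW r : 0 <= r <= R -> cball n R (ray i0 r).
  by move=> hr; rewrite /cball /= enorm_ray ger0_norm; lra.
have d1 x (i : 'I_n) : oball n R x -> derivable u0 x (delta_mx 0 i).
  by move=> hx; exact: (der [::]).
have d2 x (i j : 'I_n) : oball n R x -> derivable (partial i u0) x (delta_mx 0 j).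
  by move=> hx; exact: (der [:: i]).
pose f' r := trace (oball n R) (partial i0 u0) (ray i0 r).
have f'E r : `|r| < R -> f' r = partial i0 u0 (ray i0 r).
  move=> hr; apply: trace_in; first exact: oball_ray.
  by apply: (ext [:: i0]); rewrite /cball /= enorm_ray ltW.
have cf : {within `[0, R], continuous (fun r => u0 (ray i0 r))}.
  apply: within_continuous_pullback c0; first exact: ray_continuous.
  by move=> r; rewrite /= in_itv; exact: cballW.
have cf' : {within `[0, R], continuous f'}.
  pose A := [set x | exists2 r, 0 <= r <= R & x = ray i0 r].
  apply: (@within_continuous_pullback _ _ _ _ A _ _ (@ray_continuous K n i0)).
    by move=> r; rewrite /= in_itv => hr; exists r.
  apply: trace_continuous => x [r hr ->]; last exact: closure_ray.
  by apply: (ext [:: i0]); exact: cballW.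
have df r : 0 <= r < R -> is_derive r 1 (fun r => u0 (ray i0 r)) (f' r).
  move=> hr; rewrite f'E; last by rewrite ger0_norm; lra.
  by apply: is_derive_ray; apply: d1; exact: ballW.
have df' r : 0 <= r < R -> is_derive r 1 f' (partial i0 (partial i0 u0) (ray i0 r)).
  move=> hr; have d0 : 0 < R - r by lra.
  apply: is_derive_near d0 _ (is_derive_ray (g := partial i0 u0) _) => [s hs|].
    rewrite f'E //.
    have := ler_normD (s - r) r; rewrite subrK; have := ger0_norm (x := r); lra.
  by apply: d2; exact: ballW.
have f'0 : f' 0 = 0.
  rewrite f'E ?normr0 // /ray scale0r.
  exact: (partial_center i0 hR hu0_radial).
have f'R : f' R = expR (q * u0 (ray i0 R)).
  by rewrite -hu0_bnd ?enorm_ray ?gtr0_norm // normal_derivative_ray.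
clearbody f'.
have sub r : 0 <= r < R -> a <= rad_lap n%:R r (f' r)
    (partial i0 (partial i0 u0) (ray i0 r)) + lambda * expR (p * u0 (ray i0 r)).
  move=> hr; have hx : cball n R (ray i0 r) by exact/ltW/ballW.
  have trace_lap : trace (oball n R) (laplacian u0) (ray i0 r) = laplacian u0 (ray i0 r).
    exact: trace_in (ballW r hr) (cvg_laplacian hu0_smooth hx).
  have f'r : f' r = partial i0 u0 (ray i0 r).
    by apply: f'E; case/andP: hr => h0 h1; rewrite ger0_norm.
  have := hu0_a _ hx; rewrite trace_lap f'r => /le_trans; apply.
  by rewrite (laplacian_ray i0 hR hu0_radial d1 d2 hr).
(* The initial condition is given in the open ball only; at [r = R] both sides are limits from the
   left along the ray. *)
have init r : 0 <= r <= R -> u (ray i0 r) 0 = u0 (ray i0 r).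
  move=> hr; have [->|rR] := eqVneq r R; last first.
    apply: (sol_initial hu); apply: ballW; rewrite lt_neqAle rR; lra.
  have P := flow_profile S hT.
  have h00 : 0 <= (0 : K) <= 0 by rewrite lexx.
  have cu := continuous2_section (profile_continuous P) h00.
  have l1 := within_continuous_left hR cu.
  have l2 := within_continuous_left hR cf.
  have near_R : \forall s \near R^'-, u0 (ray i0 s) = u (ray i0 s) 0.
    near=> s; apply/esym/(sol_initial hu)/ballW/andP; split.
      by apply: ltW; near: s; exact: nbhs_left_gt.
    by near: s; exact: nbhs_left_lt.
  have l3 : u (ray i0 s) 0 @[s --> R^'-] --> u0 (ray i0 R).
    exact: cvg_trans (near_eq_cvg near_R) l2.
  exact: cvg_unique l1 l3.
have [c c00 Hc] := radial_flow_rate hR hp hq hlambda n1 ha hT S cf df df'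
  (within_continuous_left hR cf') f'0 f'R sub
  (fun r hr => hu0_ge0 _ (cballW r hr)) init.
(* This constant is [c] to the power [-1 / q], as found by taking logarithms in
   [c * (T - t) <= expR (- (q * u))]. *)
exists (expR (- (q^-1 * ln c))); first exact: expR_gt0.
move=> t ht x xR; have Tt : 0 < T - t by lra.
have -> : u x t = u (ray i0 R) t.
  have ht' : 0 <= t < T by lra.
  by apply: (hu_radial _ ht'); rewrite /cball /= ?xR ?enorm_ray ?gtr0_norm.
have := Hc t ht; rewrite -[leLHS]lnK ?posrE ?mulr_gt0 // ler_expR lnM ?posrE //.
rewrite expRK => H; rewrite -(ler_pM2l hq).
have -> : q * (- (q^-1 * ln c) - q^-1 * ln (T - t)) = - (ln c + ln (T - t)).
  by field; rewrite gt_eqF.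
lra.
Unshelve. all: by end_near.
Qed.
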